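(* Let $G=\langle X\mid R\rangle$ be a group with $X$ finite and $R$ not necessarily finite. Suppose that there exist a set $P$ of infinitely many primes, a freely reduced $X$-word $w$ (the same for all $p\in P$), and a collection $\{\Gamma_p\}_{p\in P}$ of $X$-graphs such that for every $p\in P$: $\Gamma_p$ is an $X$-regular connected $X$-graph which fulfills the defining relators $R$ and has exactly $p$ vertices, and there is a base-vertex $v$ of $\Gamma_p$ such that $$\{t(p_i)\mid 0\le i<p\}=V(\Gamma_p),$$ where $p_i$ denotes the reduced path in $\Gamma_p$ with origin $o(p_i)=v$ and label $\mu(p_i)=w^i$. Then the nerve complex $\mathcal{NC}(G,\mathscr H_{\mathrm{fi}})$ and the order complex $\Delta P_{\mathrm{fi}}(G)$ are contractible.
   Context: $\mathscr H_{\mathrm{fi}}$ is the set of all proper finite index subgroups of $G$, and $P_{\mathrm{fi}}(G)=\{Hg\mid H<G \text{ proper},\ [G:H]<\infty,\ g\in G\}$ is the set of all right cosets of such subgroups, partially ordered by inclusion. The order complex $\Delta P$ of a poset $P$ is the simplicial complex whose $n$-simplices are the chains $C_0\subset C_1\subset\dots\subset C_n$ in $P$. The nerve complex $\mathcal{NC}(G,\mathscr H)$ of $G$ with respect to a set $\mathscr H$ of subgroups is the simplicial complex with an $n$-simplex for every set $\{H_0g_0,\dots,H_ng_n\}$ of $n+1$ cosets with $H_i\in\mathscr H$, $g_i\in G$ and $H_0g_0\cap\dots\cap H_ng_n\ne\emptyset$. $F(X)$ is the free group on $X$, realized as the freely reduced words in $X\cup X^{-1}$ (powers $w^i$ are taken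 in $F(X)$, i.e. freely reduced); $R\subseteq F(X)$. An $X$-graph is a directed graph $\Gamma$ (loops and multiple edges allowed) in which every directed edge $e$, with origin $o(e)$ and terminus $t(e)$, carries a label $\mu(e)\in X$. $\widehat\Gamma$ is obtained by adding, for each edge $e$, a formal inverse $e^{-1}$ with $o(e^{-1})=t(e)$, $t(e^{-1})=o(e)$, $\mu(e^{-1})=\mu(e)^{-1}$. A path $p$ in $\Gamma$ is a sequence $e_1,\dots,e_k$ of edges of $\widehat\Gamma$ with $o(e_i)=t(e_{i-1})$; $o(p)=o(e_1)$, $t(p)=t(e_k)$, $\mu(p)=\mu(e_1)\cdots\mu(e_k)$; a single vertex is also a path, with empty label. A path is reduced if it has no subpath $e,e^{-1}$ with $e$ an edge of $\widehat\Gamma$. $\Gamma$ is $X$-regular if for every vertex $v$ and every $x\in X\cup X^{-1}$ there is exactly one edge in $\widehat\Gamma$ with origin $v$ and label $x$. $\Gamma$ fulfills the defining relators $R$ if for every vertex $v$ and every $r\in R$, each reduced path with origin $v$ and label $r$ has terminus $v$. *)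

(* Defs.v *)
From HB Require Import structures.
From mathcomp Require Import all_boot all_order all_algebra.
From mathcomp Require Import all_classical all_reals all_analysis.
Import Order.TTheory GRing.Theory Num.Theory.
Import numFieldNormedType.Exports.

Set Implicit Arguments.
Unset Strict Implicit.
Unset Printing Implicit Defensive.

Local Open Scope classical_set_scope.

(* The letter [(x, true)] is x and [(x, false)] is its formal inverse. *)
Definition letter (X : Type) : Type := (X * bool)%type.

Definition inv_letter (X : Type) (a : letter X) : letter X := (a.1, ~~ a.2).

Section FreeGroup.
Variable X : choiceType.
Implicit Types (a b : X * bool) (s t u : seq (X * bool)).

Definition freely_reduced s := sorted (fun a b => b != inv_letter a) s.

Definition cons_reduce a s : seq (X * bool) :=
  if s is b :: s' then if b == inv_letter a then s' else a :: s else [:: a].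

Definition inv_word s : seq (X * bool) := rev (map (@inv_letter X) s).

Record free_group := FreeGroup {
  word_of :> seq (X * bool);
  _ : freely_reduced word_of
}.

HB.instance Definition _ := [isSub for word_of].
HB.instance Definition _ := [Choice of free_group by <:].

Lemma inv_letterK : involutive (@inv_letter X).
Proof. by case=> x b; rewrite /inv_letter /= negbK. Qed.

Lemma cons_reduce_red a s : freely_reduced s -> freely_reduced (cons_reduce a s).
Proof.
case: s => [|b s] //=; case: eqP => [_ | /eqP ba /=]; first exact: path_sorted.
by rewrite /freely_reduced /= ba.
Qed.

Lemma foldr_reduce_red s t :
  freely_reduced t -> freely_reduced (foldr cons_reduce t s).
Proof. by move=> rt; elim: s => //= a s; exact: cons_reduce_red. Qed.

Lemma cons_reduceK a s :
  freely_reduced s -> cons_reduce a (cons_reduce (inv_letter a) s) = s.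
Proof.
case: s => [|b s] /=; first by rewrite eqxx.
rewrite inv_letterK; case: eqP => [-> | _] rs /=; last by rewrite eqxx.
by case: s rs => [|c s] //= /andP[/negbTE ->].
Qed.

Lemma cons_reduce_id a s :
  freely_reduced (a :: s) -> cons_reduce a s = a :: s.
Proof. by case: s => [|b s] //= /andP[/negbTE ->]. Qed.

Lemma foldr_reduce_nil s : freely_reduced s -> foldr cons_reduce [::] s = s.
Proof.
elim: s => //= a s IHs ras; rewrite IHs ?cons_reduce_id //.
exact: path_sorted ras.
Qed.

Lemma foldr_cons_reduce a s t : freely_reduced t ->
  foldr cons_reduce t (cons_reduce a s) =
  cons_reduce a (foldr cons_reduce t s).
Proof.
move=> rt; case: s => [|b s] //=; case: eqP => [-> | _] //=.
by rewrite cons_reduceK //; exact: foldr_reduce_red.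
Qed.

Lemma foldr_reduceA s t u : freely_reduced u ->
  foldr cons_reduce u (foldr cons_reduce t s) =
  foldr cons_reduce (foldr cons_reduce u t) s.
Proof. by move=> ru; elim: s => //= a s <-; rewrite foldr_cons_reduce. Qed.

Lemma foldr_inv_word s t : freely_reduced t ->
  foldr cons_reduce (foldr cons_reduce t s) (inv_word s) = t.
Proof.
move=> rt; rewrite /inv_word; elim: s => //= a s IHs.
rewrite rev_cons foldr_rcons -{2}(inv_letterK a) cons_reduceK //.
exact: foldr_reduce_red.
Qed.

Lemma inv_wordK : involutive inv_word.
Proof.
by move=> s; rewrite /inv_word map_rev revK -map_comp (eq_map inv_letterK) map_id.
Qed.

Lemma inv_word_red s : freely_reduced s -> freely_reduced (inv_word s).
Proof.
rewrite /inv_word /freely_reduced rev_sorted sorted_map.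
by apply: sub_sorted => a b; apply: contraNneq => /= ->; rewrite inv_letterK.
Qed.

Lemma free_group_red (u : free_group) : freely_reduced u.
Proof. by case: u. Qed.

Definition free_one : free_group := @FreeGroup [::] isT.
Definition free_mul (u v : free_group) : free_group :=
  FreeGroup (foldr_reduce_red u (free_group_red v)).
Definition free_inv (u : free_group) : free_group :=
  FreeGroup (inv_word_red (free_group_red u)).

Fact free_mulA : associative free_mul.
Proof.
move=> u v t; apply: val_inj => /=.
by rewrite foldr_reduceA //; exact: free_group_red.
Qed.

Fact free_mul1 : left_id free_one free_mul.
Proof. by move=> u; exact: val_inj. Qed.

Fact free_mulr1 : right_id free_one free_mul.
Proof.
by move=> u; apply: val_inj; exact: foldr_reduce_nil (free_group_red u).
Qed.

Fact free_mulV : left_inverse free_one free_inv free_mul.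
Proof.
move=> u; apply: val_inj => /=.
by rewrite -{1}(foldr_reduce_nil (free_group_red u)) foldr_inv_word.
Qed.

Fact free_mulrV : right_inverse free_one free_inv free_mul.
Proof.
move=> u; have {1}-> : u = free_inv (free_inv u).
  by apply: val_inj; rewrite /= inv_wordK.
exact: free_mulV.
Qed.

HB.instance Definition _ :=
  isGroup.Build free_group free_mulA free_mul1 free_mulr1 free_mulV free_mulrV.

End FreeGroup.

Section Subgroups.
Variable G : groupType.
Implicit Types H N C : set G.

Definition is_subgroup H : Prop := group_closed (mem H).

Definition is_normal_subgroup N : Prop :=
  is_subgroup N /\ forall g n, N n -> N (n ^ g)%g.

Definition right_coset H (g : G) : set G := [set (h * g)%g | h in H].

Definition finite_index H : Prop := finite_set (range (right_coset H)).

Definition cosets (HH : set (set G)) : set (set G) :=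
  [set C | exists2 H, HH H & exists g, C = right_coset H g].

End Subgroups.

Definition H_fi (G : groupType) : set (set G) :=
  [set H | [/\ is_subgroup H, H != setT & finite_index H]].
Arguments H_fi G : clear implicits.

Definition P_fi (G : groupType) : set (set G) := cosets (H_fi G).
Arguments P_fi G : clear implicits.

(* G = <X | Rel> up to isomorphism, i.e. G is F(X) modulo the normal closure of
   [Rel]. *)
Definition has_presentation (X : choiceType) (Rel : set (free_group X))
    (G : groupType) : Prop :=
  exists phi : {multiplicative (free_group X) -> G},
    (forall g, exists u, phi u = g) /\
    [set u | phi u = 1%g] = smallest (@is_normal_subgroup _) Rel.

Record xgraph (X : Type) := XGraph {
  vertex :> Type;
  edge : Type;
  edge_origin : edge -> vertex;
  edge_terminus : edge -> vertex;
  edge_label : edge -> X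
}.

Section XGraphs.
Variables (X : choiceType) (Gamma : xgraph X).

(* The edges of Gamma with formal inverses adjoined: [(e, true)] is e and
   [(e, false)] is its inverse. *)
Definition hedge : Type := (edge Gamma * bool)%type.

Definition hinv (e : hedge) : hedge := (e.1, ~~ e.2).
Definition horigin (e : hedge) : Gamma :=
  if e.2 then edge_origin e.1 else edge_terminus e.1.
Definition hterminus (e : hedge) : Gamma :=
  if e.2 then edge_terminus e.1 else edge_origin e.1.
Definition hlabel (e : hedge) : letter X := (edge_label e.1, e.2).

Fixpoint is_walk (v : Gamma) (es : seq hedge) : Prop :=
  if es is e :: es' then horigin e = v /\ is_walk (hterminus e) es' else True.

(* The origin is stored so that a single vertex is a path. *)
Record xpath := XPath {
  porigin : Gamma;
  pedges : seq hedge;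
  pedges_walk : is_walk porigin pedges
}.

Definition pterminus (p : xpath) : Gamma :=
  last (porigin p) (map hterminus (pedges p)).

Definition plabel (p : xpath) : seq (letter X) := map hlabel (pedges p).

Definition preduced (p : xpath) : Prop :=
  forall (s t : seq hedge) (e : hedge), pedges p <> s ++ e :: hinv e :: t.

Definition xgraph_connected : Prop :=
  forall u v : Gamma, exists p, porigin p = u /\ pterminus p = v.

Definition xregular : Prop :=
  forall (v : Gamma) (a : letter X),
    exists! e : hedge, horigin e = v /\ hlabel e = a.

Definition fulfills_relators (Rel : set (free_group X)) : Prop :=
  forall (v : Gamma) (r : free_group X), Rel r ->
  forall p, preduced p -> porigin p = v -> plabel p = r -> pterminus p = v.

End XGraphs.

Record simplicial_complex (V : Type) := SimplicialComplex {
  simplex : set (set V);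
  simplex_finite : forall s, simplex s -> finite_set s;
  simplex_neq0 : forall s, simplex s -> s !=set0;
  simplex_face : forall s t,
    simplex s -> t `<=` s -> t !=set0 -> simplex t
}.

Section OrderComplex.
Variables (d : Order.disp_t) (T : porderType d) (P : set T).

Definition is_chain (s : set T) : Prop :=
  [/\ finite_set s, s !=set0, s `<=` P & total_on s (fun x y => x <= y)%O].

Fact is_chain_face s t : is_chain s -> t `<=` s -> t !=set0 -> is_chain t.
Proof.
move=> [sfin _ sP stot] ts t0; split => //.
- exact: sub_finite_set sfin.
- exact: subset_trans sP.
- by move=> x y tx ty; apply: stot; exact: ts.
Qed.

Definition order_complex : simplicial_complex T :=
  @SimplicialComplex T is_chain
    (fun s cs => let: And4 h _ _ _ := cs in h)
    (fun s cs => let: And4 _ h _ _ := cs in h) is_chain_face.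

End OrderComplex.

Section NerveComplex.
Variables (G : groupType) (HH : set (set G)).

Definition is_nerve_simplex (s : set (set G)) : Prop :=
  [/\ finite_set s, s !=set0, s `<=` cosets HH & \bigcap_(C in s) C !=set0].

Fact is_nerve_simplex_face s t :
  is_nerve_simplex s -> t `<=` s -> t !=set0 -> is_nerve_simplex t.
Proof.
move=> [sfin _ sP [g sg]] ts t0; split => //.
- exact: sub_finite_set sfin.
- exact: subset_trans sP.
- by exists g => C /ts; exact: sg.
Qed.

Definition nerve_complex : simplicial_complex (set G) :=
  @SimplicialComplex (set G) is_nerve_simplex
    (fun s cs => let: And4 h _ _ _ := cs in h)
    (fun s cs => let: And4 _ h _ _ := cs in h) is_nerve_simplex_face.

End NerveComplex.

Local Open Scope ring_scope.

Section Realization.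
Variables (R : realType) (V : choiceType) (K : simplicial_complex V).

(* Points are given by their barycentric coordinates. *)
Definition geometric_simplex (s : set V) : set {ptws V -> R} :=
  [set x | [/\ forall v, 0 <= x v, forall v, ~ s v -> x v = 0
            & \sum_(v \in s) x v = 1]].

Record realization := RealizationPoint {
  coords : {ptws V -> R};
  coords_simplex : exists2 s, simplex K s & geometric_simplex s coords
}.

HB.instance Definition _ := gen_eqMixin realization.
HB.instance Definition _ := gen_choiceMixin realization.

(* The coherent topology: a set is open iff its trace on every closed simplex
   is open, where a simplex has its Euclidean topology (on the points supported
   in a finite set this is the topology of pointwise convergence).  This is not
   the subspace topology of [{ptws V -> R}] when K is infinite. *)
Definition realization_open (U : set realization) : Prop :=
  forall s, simplex K s -> open (coords @` U : set (subspace (geometric_simplex s))).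

Lemma coords_inj : injective coords.
Proof.
move=> [x hx] [y hy] /= xy; subst y; congr RealizationPoint.
exact: Prop_irrelevance.
Qed.

Fact realization_openT : realization_open setT.
Proof.
move=> s Ks; apply/open_subspaceP; exists setT; first exact: openT.
apply/seteqP; split => x [_ sx]; split => //.
by exists (RealizationPoint (ex_intro2 _ _ s Ks sx)).
Qed.

Fact realization_openI : setI_closed realization_open.
Proof.
move=> A B oA oB s Ks; rewrite (_ : _ @` _ = coords @` A `&` coords @` B).
  by apply: openI; [exact: oA | exact: oB].
apply/seteqP; split => [_ [x [Ax Bx] <-] | _ [[x Ax <-] [y By /coords_inj yx]]].
  by split; exists x.
by exists x => //; split => //; rewrite -yx.
Qed.

Fact realization_open_bigU (I : Type) (f : I -> set realization) :
  (forall i, realization_open (f i)) -> realization_open (\bigcup_i f i).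
Proof.
move=> of_ s Ks; rewrite image_bigcup; apply: bigcup_open => i _.
exact: of_.
Qed.

HB.instance Definition _ := @isOpenTopological.Build realization
  realization_open realization_openT realization_openI realization_open_bigU.

End Realization.

Definition contractible (R : realType) (T : topologicalType) : Prop :=
  exists (x0 : T) (H : T * R -> T),
    [/\ {within [set: T] `*` `[0, 1], continuous H},
        forall x, H (x, 0) = x & forall x, H (x, 1) = x0].

Definition contractible_complex (R : realType) (V : choiceType)
    (K : simplicial_complex V) : Prop :=
  contractible R (realization R K).

(* Main.v *)
Require Import Defs.
From HB Require Import structures.
From mathcomp Require Import all_boot all_order all_algebra finmap.
From mathcomp Require Import all_classical all_reals all_analysis.
From mathcomp Require Import lra zify.
Import Order.TTheory GRing.Theory Num.Theory.
Import numFieldNormedType.Exports.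

Set Implicit Arguments.
Unset Strict Implicit.
Unset Printing Implicit Defensive.

Local Open Scope classical_set_scope.
Local Open Scope ring_scope.

(** Let b be the image of w in G.  For p in P, the free group acts on the
vertices of the graph with p vertices by following edges; the relators act
trivially, so the action descends to G, and the stabilizer M_p of the base
vertex is a subgroup of index p.  Since the first p powers of w carry the base
vertex to all p vertices, b acts as a single p-cycle on the cosets of M_p
([cyclic_iter]).  A coset C of a subgroup of finite index satisfies C b^d = C
for some d > 0 ([exists_period]).  If cosets C_1, ..., C_k with a common point g
have periods smaller than p, and D is the product of these periods, then D is
prime to p; all g b^(Dj) lie in the C_i, and one of them lies in M_p
([stabilizer_meets]).  Hence M_p can be added as a vertex to every simplex of
the nerve whose vertices have periods smaller than p.

Let p_0 < p_1 < ... be primes in P, a_n the vertex M_(p_n), and let the level of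
a coset be the first n such that p_n exceeds one of its periods.  A simplex
together with any finite set of vertices a_n whose indices are at least the
levels of its vertices is again a simplex.  This does not make the complex a
cone, but there is an explicit contraction all the same ([cone_null_homotopic]).
At time tau every barycentric coordinate y_v is cut down to max(0, y_v - tau),
and a mass tau is spread over the a_n, where a_n receives the length of the
interval of those theta < tau for which n is the last index with c_n > theta;
here c_n is the total mass of the vertices of level at least n.  If a_n gets
mass and v survives, then y_v > tau >= c_(n+1), so v has level at most n: the
support stays in a simplex.  At tau = 1 only the a_n are left; these span a full
simplex, which is contracted linearly to a_0.

The order complex is a subcomplex of the nerve, since a chain of cosets meets
in its least element.  Conversely, sending a finite set of cosets with a common
point to its intersection turns increasing flags of simplices into chains, and
so defines a map r from the nerve (through its barycentric subdivision) to the
order complex.  On the order complex r stays in the simplex of its argument, so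
it is homotopic to the identity by straight lines ([order_complex_retract]), and
the order complex inherits contractibility from the nerve.

All these maps and homotopies are given by finitely supported weights that
depend continuously on the coordinates and on time.  That such formulas are
continuous for the coherent topology is [pushforward_map].  For homotopies this
needs that the product of the complex with the line is again coherent, which
follows from the tube lemma for compact intervals ([continuous_induced_map]). *)

(** * Maps between realizations given by coordinates *)

(** Convergence in a product of a closed simplex with the line; both the
coherent topology and joint continuity in time are tested on these filters. *)
Definition simplex_nbhs (R : realType) (V : choiceType) (s : set V)
    (y : {ptws V -> R}) (t : R) : set_system ({ptws V -> R} * R) :=
  filter_prod (within (@geometric_simplex R V s) (nbhs y)) (nbhs t).

#[global] Instance simplex_nbhs_filter (R : realType) (V : choiceType)
  (s : set V) (y : {ptws V -> R}) (t : R) : Filter (simplex_nbhs s y t).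
Proof. by apply: filter_prod_filter. Qed.
#[global] Typeclasses Opaque simplex_nbhs.

Section RealizationMaps.
Variable R : realType.

Lemma cvg_coord (V : choiceType) (F : set_system {ptws V -> R}) (y : {ptws V -> R}) u :
  Filter F -> F --> y -> x u @[x --> F] --> y u.
Proof.
move=> FF Fy; apply: cvg_trans (@proj_continuous V (fun=> R) u y).
exact: (cvg_app (@proj V (fun=> R) u) Fy).
Qed.

Lemma cvg_ptws (V : choiceType) (F : set_system {ptws V -> R}) (y : {ptws V -> R}) :
  Filter F -> (forall u, x u @[x --> F] --> y u) -> F --> y.
Proof.
move=> FF Fy; apply/cvg_sup => u U [_ [[W oW <-]] Wy /filterS]; apply.
by apply: (Fy u); exact: open_nbhs_nbhs.
Qed.

Lemma simplex_nbhs_in (V : choiceType) (s : set V) (y : {ptws V -> R}) (t : R) :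
  \forall z \near simplex_nbhs s y t, geometric_simplex s z.1.
Proof.
exists (geometric_simplex s, setT); first by split; [exact: withinT|exact: filterT].
by case=> a b [].
Qed.

Lemma simplex_nbhs_coord (V : choiceType) (s : set V) (y : {ptws V -> R}) (t : R) u :
  z.1 u @[z --> simplex_nbhs s y t] --> y u.
Proof.
apply: (@cvg_comp _ _ _ fst (fun x : {ptws V -> R} => x u)
  _ (within (geometric_simplex s) (nbhs y))); first exact: cvg_fst.
by apply: cvg_coord; exact: cvg_within.
Qed.

Lemma simplex_nbhs_time (V : choiceType) (s : set V) (y : {ptws V -> R}) (t : R) :
  z.2 @[z --> simplex_nbhs s y t] --> t.
Proof. exact: cvg_snd. Qed.

Lemma fsum_simplex (V : choiceType) (s : set V) (x : V -> R) (A : {fset V}) :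
  finite_set s -> (forall v, ~ s v -> x v = 0) -> (forall v, v \notin A -> x v = 0) ->
  \sum_(v \in s) x v = \sum_(v <- A) x v.
Proof.
move=> fs xs xA; rewrite -(@fsbigTE _ _ _ _ A)//.
apply: fsbig_widen => // v [_ /xs]; exact.
Qed.

Lemma closed_geometric_simplex (V : choiceType) (s : set V) :
  finite_set s -> closed (@geometric_simplex R V s).
Proof.
move=> fs x clx.
pose F := within (@geometric_simplex R V s) (nbhs x).
have PF : ProperFilter F by exact: within_nbhs_proper.
have cF v : y v @[y --> F] --> x v by apply: cvg_coord; exact: cvg_within.
have inF : \forall y \near F, geometric_simplex s y by exact: withinT.
split.
- move=> v; apply: (cvgr_to_ge (cF v)); by apply: filterS inF => y [].
- move=> v nsv; apply: (cvg_unique _ (cF v)) => //.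
  apply: cvg_near_cst; by apply: filterS inF => y [_ + _] => /(_ _ nsv) ->.
- rewrite fsbig_finite//.
  have c : \sum_(v <- fset_set s) y v @[y --> F] --> \sum_(v <- fset_set s) x v.
    by apply: cvg_big => // z; exact: add_continuous.
  apply: (cvg_unique _ c) => //.
  by apply: cvg_near_cst; apply: filterS inF => y [_ _]; rewrite fsbig_finite.
Qed.

Section Map.
Variables (V V' : choiceType).
Variables (K : simplicial_complex V) (K' : simplicial_complex V').
Variable phi : {ptws V -> R} -> R -> {ptws V' -> R}.
Hypothesis phi_in : forall (x : realization R K) t,
  exists2 s', simplex K' s' & geometric_simplex s' (phi (coords x) t).
Hypothesis phi_fin : forall s, simplex K s ->
  exists A : {fset V'}, forall y t u,
    geometric_simplex s y -> u \notin A -> phi y t u = 0.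
Hypothesis phi_cvg : forall s, simplex K s -> forall y t u,
  geometric_simplex s y ->
  phi z.1 z.2 u @[z --> simplex_nbhs s y t] --> phi y t u.

Definition induced_map (z : realization R K * R) : realization R K' :=
  RealizationPoint (phi_in z.1 z.2).

(** The image of one closed simplex lies in finitely many simplices, because the
supports of its points lie in one finite set A.  Near a given point each subset B
of A is harmless: the closed simplex B either misses the image point, hence a
neighbourhood of it, or it contains the image point, and then the trace of U
on B is open. *)
Lemma induced_map_near_simplex s y t (x : realization R K)
    (U : set (realization R K')) :
  simplex K s -> geometric_simplex s y -> coords x = y ->
  open U -> U (induced_map (x, t)) ->
  \forall z \near simplex_nbhs s y t, forall x', coords x' = z.1 ->
    U (induced_map (x', z.2)).
Proof.
move=> Ks sy xy oU Ux; have [A phiA] := phi_fin Ks.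
have phic : phi z.1 z.2 @[z --> simplex_nbhs s y t] --> phi y t.
  by apply: cvg_ptws => u; exact: phi_cvg.
have allB : \forall z \near simplex_nbhs s y t,
    (\bigcap_(B in [set` fpowerset A])
      [set z | simplex K' [set` B] ->
          geometric_simplex [set` B] (phi z.1 z.2) ->
          forall x', coords x' = z.1 -> U (induced_map (x', z.2))]) z.
  apply: filter_bigI => B _.
  have [KB|nKB] := pselect (simplex K' [set` B]); last first.
    by apply: (@filterS _ _ (simplex_nbhs_filter s y t) setT) filterT => z _ /nKB.
  have [By|nBy] := pselect (geometric_simplex [set` B] (phi y t)); last first.
    have : \forall z \near simplex_nbhs s y t,
        (~` geometric_simplex [set` B]) (phi z.1 z.2).
      apply: phic; apply: open_nbhs_nbhs; split => //.
      by apply: closed_openC; apply: closed_geometric_simplex.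
    by apply: filterS => z nB.
  have /open_subspaceP[W oW WU] := oU _ KB.
  have Wy : W (phi y t).
    suff : (W `&` geometric_simplex [set` B]) (phi y t) by case.
    by rewrite WU; split => //; exists (induced_map (x, t)); rewrite //= xy.
  have : \forall z \near simplex_nbhs s y t, W (phi z.1 z.2).
    by apply: phic; exact: open_nbhs_nbhs.
  apply: filterS => z Wz _ Bz x' x'z.
  have : (W `&` geometric_simplex [set` B]) (phi z.1 z.2) by [].
  rewrite WU => -[[q Uq qz] _].
  rewrite (_ : induced_map _ = q)//; apply: coords_inj.
  by rewrite qz /= x'z.
(* A point carried by s' and supported in A is carried by the face s' & A of s'. *)
have inS := simplex_nbhs_in s y t.
apply: filterS2 allB inS => z allz sz x' x'z.
have [s' Ks' s'z] := phi_in x' z.2; rewrite x'z in s'z.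
pose B := [fset v in A | v \in s']%fset.
have Bs' : [set` B] `<=` s' by move=> v /=; rewrite !inE => /andP[_ /set_mem].
have B0 v : v \notin B -> phi z.1 z.2 v = 0.
  rewrite !inE negb_and => /orP[/phiA|/negP vs]; first exact.
  by case: s'z => _ + _; apply; apply: contra_not vs => /mem_set.
have sB : \sum_(v <- B) phi z.1 z.2 v = 1.
  case: (s'z) => _ h <-; rewrite (@fsum_simplex _ _ _ B)//.
  exact: simplex_finite Ks'.
have Bn0 : [set` B] !=set0.
  apply/set0P/eqP => B00; move: sB.
  rewrite (_ : B = fset0) ?big_seq_fset0; last first.
    by apply/fsetP => v; rewrite [RHS]inE; apply/negP => vB;
       have : [set` B] v by []; rewrite B00.
  by move/esym/eqP; rewrite oner_eq0.
apply: (allz B) => //=.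
- by rewrite fpowersetE; apply/fsubsetP => v; rewrite !inE => /andP[].
- exact: simplex_face Ks' Bs' Bn0.
- split; [by case: s'z|by move=> v /negP; exact: B0|].
  by rewrite -sB [RHS]fsbig_seq ?fset_uniq.
Qed.

(** Openness in the product topology is more than openness on each product of a
simplex with the line.  The gap is bridged by a compact interval J around t0
with {x0} x J inside the preimage of U: the points x with {x} x J inside it form
a set that is open on every simplex by the tube lemma, hence open. *)
Lemma continuous_induced_map : continuous induced_map.
Proof.
move=> [x0 t0] W; rewrite nbhsE => -[U [oU Ux] UW].
apply: filterS UW _.
have [s Ks sx] := coords_simplex x0.
have /= near0 := induced_map_near_simplex Ks sx erefl oU Ux.
have [e e0 Ue] : exists2 e, 0 < e & forall t, t0 - e <= t <= t0 + e ->
    U (induced_map (x0, t)).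
  case: near0 => -[A B] /= [Ax /nbhs_ballP[e /= e0 eB]] AB.
  exists (e / 2); first by rewrite divr_gt0.
  move=> t te; apply: (AB (coords x0, t)) => //=; split => /=.
    exact: nbhs_singleton Ax sx.
  apply: eB; rewrite /ball /= distrC (@le_lt_trans _ _ (e / 2))//.
    by rewrite ler_distl.
  by rewrite ltr_pdivrMr// ltr_pMr// ltr1n.
pose J : set R := `[t0 - e, t0 + e]%classic.
pose W0 := [set x | forall t, J t -> U (induced_map (x, t))].
have oW0 : open W0.
  move=> s1 Ks1; rewrite openE => _ [x Wx <-].
  rewrite /interior /=; case: (nbhs_subspaceP (geometric_simplex s1) (coords x)) =>
      [s1x|_]; last by move=> _ ->; exists x.
  have cJ : compact J by exact: segment_compact.
  have nearJ : \forall y \near within (geometric_simplex s1) (nbhs (coords x)),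
      J `<=` [set t | forall x', coords x' = y -> U (induced_map (x', t))].
    apply: (iffLR (compact_near_coveringP J) cJ) => t Jt.
    have [[A B] /= [Ax Bt] AB] :=
      induced_map_near_simplex Ks1 s1x erefl oU (Wx t Jt).
    by exists (B, A) => // -[a b] /= [Ba Ab]; exact: (AB (b, a)).
  have near_s1 : \forall y \near within (geometric_simplex s1) (nbhs (coords x)),
      geometric_simplex s1 y by exact: withinT.
  apply: filterS2 nearJ near_s1 => y Jy s1y.
  pose x' : realization R K := RealizationPoint (ex_intro2 _ _ s1 Ks1 s1y).
  exists x'; last by [].
  by move=> t Jt; exact: (Jy t Jt).
exists (W0, J); last by move=> -[x t] /= [Wx Jt]; exact: Wx.
split => /=.
  by apply: open_nbhs_nbhs; split => // t; rewrite /J /= in_itv /=; exact: Ue.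
apply/nbhs_ballP; exists e => //= t; rewrite /ball /= distrC ltr_distl.
by rewrite /J /= in_itv /= => /andP[/ltW -> /ltW ->].
Qed.
End Map.

End RealizationMaps.

(** The point with masses w i at the vertices g i, divided by the total mass so
that weights need not be normalized. *)
Definition pushforward (R : realType) (I V : choiceType) (g : I -> V)
    (w : I -> R) : {ptws V -> R} :=
  fun u => (\sum_(i \in g @^-1` [set u]) w i) / \sum_(i \in setT) w i.

Section Weights.
Variable R : realType.
Variables (V V' I : choiceType).
Variables (K : simplicial_complex V) (K' : simplicial_complex V').
Variables (g : I -> V') (m : {ptws V -> R} -> R -> I -> R).

Hypothesis m_ge0 : forall s y t i, simplex K s -> geometric_simplex s y ->
  0 <= m y t i.
Hypothesis m_neq0 : forall s y t, simplex K s -> geometric_simplex s y ->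
  exists i, m y t i != 0.
Hypothesis m_fin : forall s, simplex K s ->
  exists A : {fset I}, forall y t i,
    geometric_simplex s y -> i \notin A -> m y t i = 0.
Hypothesis m_in : forall s y t, simplex K s -> geometric_simplex s y ->
  exists2 s', simplex K' s' & forall i, m y t i != 0 -> s' (g i).
Hypothesis m_cvg : forall s, simplex K s -> forall y t i, geometric_simplex s y ->
  m z.1 z.2 i @[z --> simplex_nbhs s y t] --> m y t i.

Let pushE (A : {fset I}) y t u : (forall i, i \notin A -> m y t i = 0) ->
  pushforward g (m y t) u = (\sum_(i <- A | g i == u) m y t i) / \sum_(i <- A) m y t i.
Proof.
move=> mA; rewrite /pushforward (@fsbigTE _ _ _ _ A)//; congr (_ / _).
rewrite fsbig_mkcond (@fsbigTE _ _ _ _ A) /=; last first.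
  by move=> i iA; rewrite patchE mA ?if_same.
rewrite [RHS]big_mkcond; apply: eq_bigr => i _; rewrite patchE.
by case: eqP => gi; [rewrite mem_set|rewrite memNset].
Qed.

Let sum_gt0 s (A : {fset I}) y t : simplex K s -> geometric_simplex s y ->
  (forall i, i \notin A -> m y t i = 0) -> 0 < \sum_(i <- A) m y t i.
Proof.
move=> Ks sy mA; rewrite lt_neqAle sumr_ge0 ?andbT; last first.
  by move=> i _; exact: m_ge0 Ks sy.
have [i mi] := m_neq0 t Ks sy.
have iA : i \in A by apply: contraNT mi => /mA ->.
apply: contraNneq mi => /esym/eqP.
by rewrite psumr_eq0 => [/allP/(_ _ iA)|j _]; [|exact: m_ge0 Ks sy].
Qed.

Lemma pushforward_in (x : realization R K) t :
  exists2 s', simplex K' s' & geometric_simplex s' (pushforward g (m (coords x) t)).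
Proof.
have [s Ks sx] := coords_simplex x.
have [A mA] := m_fin Ks; have {}mA i := mA _ t i sx.
have [s' Ks' ms'] := m_in t Ks sx; exists s' => //.
have s_gt0 := sum_gt0 Ks sx mA.
split=> [u|u s'u|]; first 2 last.
- rewrite fsbig_finite; last exact: simplex_finite Ks'.
  under eq_bigr do rewrite (pushE _ mA).
  rewrite -mulr_suml; apply/eqP; rewrite -[1](divff (lt0r_neq0 s_gt0)); apply/eqP.
  congr (_ / _).
  under eq_bigr do rewrite big_mkcond.
  rewrite exchange_big; apply: eq_bigr => i _ /=; rewrite -big_mkcond.
  have [mi|mi] := eqVneq (m (coords x) t i) 0; first by rewrite big1.
  rewrite -big_filter (_ : [seq _ <- _ | _] = [:: g i]) ?big_seq1//.
  rewrite (eq_filter (a2 := pred1 (g i))); last by move=> u; rewrite /= eq_sym.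
  apply: filter_pred1_uniq => //.
  by rewrite in_fset_set ?mem_set//; [exact: ms'|exact: simplex_finite Ks'].
- rewrite (pushE _ mA) divr_ge0 ?(ltW s_gt0)// sumr_ge0// => i _.
  exact: m_ge0 Ks sx.
- rewrite (pushE _ mA) big1 ?mul0r// => i /eqP giu.
  by apply: contra_notP s'u => /eqP /ms'; rewrite giu.
Qed.

(** The source of all maps and homotopies below: it reduces their construction to
the choice of weights, with continuity checked one weight and one simplex at a
time. *)
Lemma pushforward_map :
  exists F : realization R K * R -> realization R K',
    continuous F /\ forall x t, coords (F (x, t)) = pushforward g (m (coords x) t).
Proof.
exists (@induced_map R V V' K K' (fun y t => pushforward g (m y t)) pushforward_in); split => //.
apply: continuous_induced_map.
  move=> s Ks; have [A mA] := m_fin Ks.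
  exists (g @` A)%fset => y t u sy uA.
  rewrite (pushE _ (fun i => mA y t i sy)) big_seq_cond big1 ?mul0r// => i /andP[iA /eqP giu].
  by case/negP: uA; rewrite -giu; apply/imfsetP; exists i.
move=> s Ks y t u sy; have [A mA] := m_fin Ks.
rewrite (pushE _ (fun i => mA y t i sy)).
have : \forall z \near simplex_nbhs s y t,
  (\sum_(i <- A | g i == u) m z.1 z.2 i) / \sum_(i <- A) m z.1 z.2 i =
   pushforward g (m z.1 z.2) u.
  apply: filterS (simplex_nbhs_in s y t) => z sz.
  by rewrite (pushE _ (fun i => mA z.1 z.2 i sz)).
move=> /near_eq_cvg e; apply: (cvg_trans e) => {e}; apply: cvgM; last first.
  apply: cvgV; first by apply: lt0r_neq0; exact: (sum_gt0 Ks sy (fun i => mA y t i sy)).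
  by apply: cvg_big => [z|i _]; [exact: add_continuous|exact: m_cvg].
by apply: cvg_big => [z|i _]; [exact: add_continuous|exact: m_cvg].
Qed.
End Weights.

(** * Homotopies *)

Section Homotopies.
Variable R : realType.

(** Time runs over the whole line, so that continuity needs no subspace topology;
a homotopy on [0, 1] extends by constants. *)
Definition homotopic (X Y : topologicalType) (f g : X -> Y) : Prop :=
  exists H : X * R -> Y,
    [/\ continuous H, forall x, H (x, 0) = f x & forall x, H (x, 1) = g x].

Lemma continuous_pair (X Y Z : topologicalType) (f : X -> Y) (g : X -> Z) :
  continuous f -> continuous g -> continuous (fun x => (f x, g x)).
Proof.
move=> cf cg x.
exact: (@cvg_pair _ _ _ (nbhs x) (nbhs (f x)) (nbhs (g x)) _ _ _ f g (cf x) (cg x)).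
Qed.

Lemma homotopic_comp (X Y Z W : topologicalType) (f g : Y -> Z)
    (h : Z -> W) (k : X -> Y) :
  continuous h -> continuous k -> homotopic f g ->
  homotopic (h \o f \o k) (h \o g \o k).
Proof.
move=> ch ck [H [cH H0 H1]]; exists (fun z => h (H (k z.1, z.2))).
split=> [z|x|x] /=; rewrite ?H0 ?H1//.
apply: (@continuous_comp _ _ _ (fun z => H (k z.1, z.2)) h); last exact: ch.
apply: (@continuous_comp _ _ _ (fun z : X * R => (k z.1, z.2)) H); last exact: cH.
apply: continuous_pair => [[x t]|[x t]]; last exact: cvg_snd.
by apply: (@continuous_comp _ _ _ fst k); [exact: cvg_fst|exact: ck].
Qed.

Lemma homotopic_trans (X Y : topologicalType) (f g h : X -> Y) :
  homotopic f g -> homotopic g h -> homotopic f h.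
Proof.
move=> [F [cF F0 F1]] [G [cG G0 G1]].
pose H (z : X * R) :=
  if z.2 <= 2^-1 then F (z.1, 2 * z.2) else G (z.1, 2 * z.2 - 1).
have cscale (b : R) : continuous (fun z : X * R => (z.1, 2 * z.2 - b)).
  apply: continuous_pair => -[x t]; first exact: cvg_fst.
  apply: cvgB; last exact: cvg_cst.
  by apply: cvgM; [exact: cvg_cst|exact: cvg_snd].
pose A : set (X * R) := [set z | z.2 <= 2^-1].
pose B : set (X * R) := [set z | 2^-1 <= z.2].
have clA : closed A.
  by apply: (@closed_comp _ _ (@snd X R) [set t | t <= 2^-1]);
    [move=> -[x t] _; exact: cvg_snd|exact: closed_le].
have clB : closed B.
  by apply: (@closed_comp _ _ (@snd X R) [set t | 2^-1 <= t]);
    [move=> -[x t] _; exact: cvg_snd|exact: closed_ge].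
exists H; split.
- have cA : {within A, continuous H}.
    apply: (@subspace_eq_continuous _ A _
      (from_subspace A (fun z => F (z.1, 2 * z.2 - 0))) (from_subspace A H)).
      by move=> z /set_mem zA; rewrite /from_subspace /H subr0 ifT.
    apply: continuous_subspaceT => z.
    by apply: continuous_comp; [exact: cscale|exact: cF].
  have cB : {within B, continuous H}.
    apply: (@subspace_eq_continuous _ B _
      (from_subspace B (fun z => G (z.1, 2 * z.2 - 1))) (from_subspace B H)).
      move=> [x t] /set_mem /= zB; rewrite /from_subspace /H /=; case: ifPn => // tB.
      have -> : t = 2^-1 by apply/eqP; rewrite eq_le tB zB.
      by rewrite divff// subrr G0 F1.
    apply: continuous_subspaceT => z.
    by apply: continuous_comp; [exact: cscale|exact: cG].
  have := withinU_continuous clA clB cA cB.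
  rewrite (_ : A `|` B = setT); first by rewrite -continuous_subspace_setT.
  by apply/seteqP; split => // z _; case: (leP z.2 2^-1) => [|/ltW]; [left|right].
- by move=> x; rewrite /H /= invr_ge0 ler0n mulr0 F0.
- move=> x; rewrite /H /= mulr1 ifF.
    by rewrite (_ : 2 - 1 = 1 :> R) ?G1//; lra.
  by apply/negbTE; rewrite -ltNge invf_lt1// ltr1n.
Qed.

Lemma contractible_of_homotopic (X : topologicalType) (x0 : X) :
  homotopic id (fun=> x0) -> contractible R X.
Proof.
move=> [H [cH H0 H1]]; exists x0, H; split => //.
exact: continuous_subspaceT.
Qed.

Lemma continuous_at0 (X Y : topologicalType) (H : X * R -> Y) :
  continuous H -> continuous (fun x => H (x, 0)).
Proof.
move=> cH x; apply: (@continuous_comp _ _ _ (fun x => (x, 0)) H); last exact: cH.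
by apply: continuous_pair => y; [exact: cvg_id|exact: cvg_cst].
Qed.

End Homotopies.

(** * Evaluating and building weights *)

Section PushforwardValues.
Variable R : realType.
Variable V : choiceType.

Lemma pushforward_restrict (I J : choiceType) (h : J -> I) (g : I -> V)
    (w : I -> R) :
  injective h -> (forall i, ~ range h i -> w i = 0) ->
  pushforward g w = pushforward (g \o h) (w \o h).
Proof.
move=> hI w0; apply/funext => u; rewrite /pushforward; congr (_ / _).
  rewrite -(@fsbig_image _ _ _ _ _ _ h w); last by move=> ? ? _ _ /hI.
  symmetry; apply: fsbig_widen; first by move=> _ [j gj <-].
  by move=> i [/= gi ni]; apply: w0 => -[j _ ji]; apply: ni; exists j; rewrite /= ?ji.
rewrite -(@fsbig_image _ _ _ _ _ _ h w); last by move=> ? ? _ _ /hI.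
by symmetry; apply: fsbig_widen => // i [_ ni]; apply: w0.
Qed.

Lemma pushforward_id (s : set V) (y : {ptws V -> R}) :
  geometric_simplex s y -> pushforward id y = y.
Proof.
move=> [_ ys sy]; apply/funext => u; rewrite /pushforward.
have <- : \sum_(v \in s) y v = \sum_(v \in setT) y v.
  by apply: fsbig_widen => // v [_ /ys].
by rewrite sy divr1 preimage_id fsbig_set1.
Qed.
End PushforwardValues.

Section Clamp.
Variable R : realType.

Definition clamp (x : R) : R := Num.max 0 (Num.min 1 x).

Lemma clamp_ge0 x : 0 <= clamp x. Proof. by rewrite le_max lexx. Qed.
Lemma clamp_le1 x : clamp x <= 1.
Proof. by rewrite ge_max ler01 ge_min lexx. Qed.
Lemma clamp0 : clamp 0 = 0.
Proof. by rewrite /clamp (min_idPr ler01) maxxx. Qed.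
Lemma clamp_le0 x : x <= 0 -> clamp x = 0.
Proof.
by move=> x0; rewrite /clamp (min_idPr _) ?(max_idPl _)// (le_trans x0).
Qed.
Lemma clamp_ge1 x : 1 <= x -> clamp x = 1.
Proof. by move=> x1; rewrite /clamp (min_idPl x1) (max_idPr ler01). Qed.

Variables (T : Type) (F : set_system T) (FF : Filter F).

Lemma cvg_max (f g : T -> R) (a b : R) : f @ F --> a -> g @ F --> b ->
  Num.max (f x) (g x) @[x --> F] --> Num.max a b.
Proof.
move=> fa gb; rewrite maxr_absE; under eq_fun do rewrite maxr_absE.
apply: cvgM; last exact: cvg_cst.
by apply: cvgD; [exact: cvgD|apply: cvg_norm; exact: cvgB].
Qed.

Lemma cvg_min (f g : T -> R) (a b : R) : f @ F --> a -> g @ F --> b ->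
  Num.min (f x) (g x) @[x --> F] --> Num.min a b.
Proof.
move=> fa gb; rewrite minr_absE; under eq_fun do rewrite minr_absE.
apply: cvgM; last exact: cvg_cst.
by apply: cvgB; [exact: cvgD|apply: cvg_norm; exact: cvgB].
Qed.

Lemma cvg_clamp (f : T -> R) (a : R) : f @ F --> a ->
  clamp (f x) @[x --> F] --> clamp a.
Proof.
by move=> fa; apply: cvg_max; [exact: cvg_cst|apply: cvg_min => //; exact: cvg_cst].
Qed.
End Clamp.

(** * Contraction by a sequence of apexes *)

Section Cone.
Variable R : realType.
Variables (V : choiceType) (K : simplicial_complex V).
Variables (a : nat -> V) (l : V -> nat).

Hypothesis cone_simplex1 : forall s n, finite_set s ->
  (s !=set0 -> simplex K s) -> (forall v, s v -> (l v <= n)%N) ->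
  simplex K (s `|` [set a n]).
Hypothesis level_apex : forall n, (l (a n) <= n.+1)%N.

(** The apexes are added in increasing order of index: a_n has level at most
n.+1, hence does not obstruct the later ones. *)
Lemma cone_simplex s (N : set nat) M : finite_set s ->
  (s !=set0 -> simplex K s) -> (forall v n, s v -> N n -> (l v <= n)%N) ->
  N `<=` `I_M -> s `|` a @` N !=set0 -> simplex K (s `|` a @` N).
Proof.
move=> fs Ks lN NM; have /setIidPl <- := NM.
elim: M {NM} => [|M IH].
  by rewrite II0 setI0 image_set0 setU0.
have [NM|nNM] := pselect (N M); last first.
  rewrite (_ : N `&` `I_M.+1 = N `&` `I_M)//.
  apply/seteqP; split=> n [Nn /=] nM; split => //=; last exact: leqW.
  by move: nM; rewrite ltnS leq_eqVlt => /predU1P[nM|//]; rewrite nM in Nn.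
move=> _; rewrite (_ : _ `|` _ = (s `|` a @` (N `&` `I_M)) `|` [set a M]).
  apply: cone_simplex1; last 2 first.
  - exact: IH.
  - move=> v [sv|[n [_ /= nM] <-]]; first exact: lN.
    exact: leq_trans (level_apex n) nM.
  rewrite finite_setU; split => //; apply: finite_image.
  by apply: finite_setIr; exact: finite_II.
rewrite -setUA; congr (_ `|` _); apply/seteqP; split => v.
  move=> [n [Nn /=]]; rewrite ltnS leq_eqVlt => /predU1P[->|nM] <-; [by right|left].
  by exists n.
move=> [[n [Nn /= nM] <-]|/= ->]; last by exists M.
by exists n => //; split => //=; exact: leqW.
Qed.

Definition tail_mass (n : nat) (y : V -> R) : R :=
  \sum_(v \in [set v | (n <= l v)%N]) y v.

(** The two phases of the contraction: [cut] is the threshold tau, which reaches 1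
at time 1/2; then [slide] moves the remaining mass linearly to the first apex. *)
Definition cut (t : R) : R := clamp (2 * t).
Definition slide (t : R) : R := clamp (2 * t - 1).

(** The differences of the numbers min(c_n, tau) telescope to tau because
c_0 = 1, so the weights of the apexes always add up to tau; and for tau = 0 the vertices
keep their masses.  So the total mass never vanishes. *)
Definition cone_weight (y : {ptws V -> R}) (t : R) (i : V + nat) : R :=
  match i with
  | inl v => Num.max 0 (y v - cut t)
  | inr n => (1 - slide t) *
        (Num.min (tail_mass n y) (cut t) - Num.min (tail_mass n.+1 y) (cut t))
      + slide t * cut t * (n == 0%N)%:R
  end.

Definition cone_vertex (i : V + nat) : V :=
  match i with inl v => v | inr n => a n end.

Lemma slide_cut t : slide t != 0 -> cut t = 1.
Proof.
move=> st; apply: clamp_ge1; rewrite leNgt; apply: contra_neqN st => lt1.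
by apply: clamp_le0; rewrite subr_le0 ltW.
Qed.

Lemma level_bound s : finite_set s -> exists M, forall v, s v -> (l v < M)%N.
Proof.
move=> fs; exists (\max_(v <- fset_set s) (l v).+1)%N => v sv.
apply: (@leq_bigmax_seq _ _ xpredT (fun v => (l v).+1)) => //.
by rewrite in_fset_set// mem_set.
Qed.

Section Simplex.
Variables (s : set V) (y : {ptws V -> R}).
Hypotheses (fs : finite_set s) (sy : geometric_simplex s y).

Let y_ge0 v : 0 <= y v. Proof. by case: sy. Qed.
Let y_out v : ~ s v -> y v = 0. Proof. by case: sy => _ + _; apply. Qed.

Lemma tail_massE n :
  tail_mass n y = \sum_(v <- fset_set s | (n <= l v)%N) y v.
Proof.
rewrite /tail_mass fsbig_mkcond (@fsbigTE _ _ _ _ (fset_set s)) /=.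
  rewrite [RHS]big_mkcond; apply: eq_bigr => v _; rewrite patchE.
  by case: (boolP (n <= l v)%N) => lv; [rewrite mem_set|rewrite memNset//; exact/negP].
move=> v; rewrite in_fset_set// => /negP vs; rewrite patchE y_out ?if_same//.
by move=> /mem_set.
Qed.

Lemma tail_mass_ge0 n : 0 <= tail_mass n y.
Proof. by rewrite tail_massE sumr_ge0. Qed.

Lemma tail_mass0 : tail_mass 0 y = 1.
Proof. by rewrite tail_massE /= -fsbig_finite//; case: sy. Qed.

Lemma tail_mass_anti n : tail_mass n.+1 y <= tail_mass n y.
Proof.
rewrite !tail_massE [leRHS](bigID (fun v => n.+1 <= l v)%N) /=.
rewrite [X in _ <= X + _](eq_bigl (fun v => n.+1 <= l v)%N) => [|v].
  by rewrite lerDl sumr_ge0.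
by rewrite andb_idl// => /ltnW.
Qed.

Lemma tail_mass_far n : (forall v, s v -> (l v < n)%N) -> tail_mass n y = 0.
Proof.
move=> sn; apply: fsbig1 => v /= nl; apply: y_out => /sn.
by rewrite ltnNge nl.
Qed.

Lemma le_tail_mass n v : (n <= l v)%N -> y v <= tail_mass n y.
Proof.
move=> nl; have [->|yv] := eqVneq (y v) 0; first exact: tail_mass_ge0.
have vs : v \in fset_set s.
  by rewrite in_fset_set// mem_set//; apply: contra_neqP yv => /y_out.
rewrite tail_massE big_mkcond (big_fsetD1 v) //= nl lerDl sumr_ge0// => u _.
by case: ifP.
Qed.

Lemma cut_ge0 t : 0 <= cut t. Proof. exact: clamp_ge0. Qed.

Lemma cut_mass_ge0 n t :
  0 <= Num.min (tail_mass n y) (cut t) - Num.min (tail_mass n.+1 y) (cut t).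
Proof.
rewrite subr_ge0 le_min !ge_min lexx orbT andbT.
by rewrite (le_trans _ (tail_mass_anti n))// lexx.
Qed.

Lemma cone_weight_ge0 t i : 0 <= cone_weight y t i.
Proof.
case: i => [v|n] /=; first by rewrite le_max lexx.
apply: addr_ge0; last by rewrite !mulr_ge0 ?clamp_ge0 ?ler0n.
by rewrite mulr_ge0 ?cut_mass_ge0// subr_ge0 clamp_le1.
Qed.

Lemma cone_weight_neq0 t : exists i, cone_weight y t i != 0.
Proof.
apply: contrapT => /forallNP all0.
have w0 i : cone_weight y t i = 0 by apply/eqP/negPn/negP.
have [c0|c_neq0] := eqVneq (cut t) 0.
  have y0 v : y v = 0.
    by have := w0 (inl v); rewrite /= c0 subr0 (max_idPr (y_ge0 v)).
  have := tail_mass0; rewrite tail_massE big1//.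
  by move/esym/eqP; rewrite oner_eq0.
have s0 : slide t = 0.
  have /eqP := w0 (inr 0%N); rewrite /= mulr1 paddr_eq0.
  - by move=> /andP[_]; rewrite mulf_eq0 (negbTE c_neq0) orbF => /eqP.
  - by rewrite mulr_ge0 ?cut_mass_ge0// subr_ge0 clamp_le1.
  - by rewrite !mulr_ge0 ?clamp_ge0 ?ler0n.
have min_c n : Num.min (tail_mass n y) (cut t) = cut t.
  elim: n => [|n IH]; first by rewrite tail_mass0 (min_idPr (clamp_le1 _)).
  have := w0 (inr n); rewrite /= s0 subr0 mul1r !mul0r addr0.
  by rewrite IH => /eqP; rewrite subr_eq0 => /eqP <-.
have [M /tail_mass_far cM] := level_bound fs.
have := min_c M; rewrite cM (min_idPl (cut_ge0 t)) => /esym/eqP.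
by rewrite (negbTE c_neq0).
Qed.

(** During the first phase, v keeps mass only if y_v > tau.  If the level of v
exceeded n, then c_n and c_(n+1) would be at least y_v, both minima would equal
tau and a_n would get nothing.  In the second phase tau = 1, and no v is left. *)
Lemma cone_weight_level t v n :
  cone_weight y t (inl v) != 0 -> cone_weight y t (inr n) != 0 ->
  (l v <= n)%N.
Proof.
move=> /= wv; apply: contra_neqT; rewrite -ltnNge => nl.
have cv : cut t < y v.
  rewrite ltNge; apply: contra_neqN wv => yc.
  by apply/max_idPl; rewrite subr_le0.
have vn := le_tail_mass nl.
have c1 : cut t < 1.
  apply: lt_le_trans cv _; rewrite -tail_mass0; exact: le_tail_mass.
have s0 : slide t = 0.
  by apply: contra_ltP c1 => /eqP /slide_cut ->.
rewrite s0 !mul0r addr0 (min_idPr _) ?(min_idPr _) ?subrr ?mulr0//.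
  by rewrite ltW// (lt_le_trans cv).
by rewrite ltW// (lt_le_trans cv)// (le_trans vn)// tail_mass_anti.
Qed.
End Simplex.

Lemma cone_weight_fin s : simplex K s ->
  exists A : {fset (V + nat)%type}, forall y t i,
    geometric_simplex s y -> i \notin A -> cone_weight y t i = 0.
Proof.
move=> /(@simplex_finite _ _) fs; have [M lM] := level_bound fs.
exists ([fset inl v | v in fset_set s] `|` [fset inr n | n in iota 0 M.+1])%fset.
move=> y t [v|n] sy; rewrite in_fsetU negb_or => /andP[iA iB] /=.
  rewrite (_ : y v = 0) ?sub0r; first by apply/max_idPl; rewrite oppr_le0 clamp_ge0.
  case: sy => _ + _; apply; apply: contraNnot iA => sv.
  by apply/imfsetP; exists v => //=; rewrite in_fset_set// mem_set.
have Mn : (M < n)%N.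
  rewrite ltnNge; apply: contra iB => nM.
  apply/imfsetP; by exists n => //; rewrite inE mem_iota; lia.
rewrite !(tail_mass_far sy); last 2 first.
- by move=> v /lM; lia.
- by move=> v /lM; lia.
by rewrite subrr mulr0 add0r gtn_eqF ?mulr0//; exact: leq_trans Mn.
Qed.

Lemma cone_weight_in s y t : simplex K s -> geometric_simplex s y ->
  exists2 s', simplex K s' & forall i, cone_weight y t i != 0 -> s' (cone_vertex i).
Proof.
move=> Ks sy; have fs := simplex_finite Ks.
pose S := [set v | cone_weight y t (inl v) != 0].
pose N := [set n | cone_weight y t (inr n) != 0].
have Ss : S `<=` s.
  move=> v; apply: contra_neqP => vs /=.
  have -> : y v = 0 by case: sy => _ + _; apply.
  by apply/max_idPl; rewrite sub0r oppr_le0 clamp_ge0.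
have [A wA] := cone_weight_fin Ks.
have [M NM] : exists M, N `<=` `I_M.
  exists (\max_(i <- A) (if i is inr n then n.+1 else 0))%N => n /= Nn.
  apply: (@leq_bigmax_seq _ _ xpredT
    (fun i : (V + nat)%type => if i is inr n then n.+1 else 0%N) (inr n)) => //.
  by apply: contraNT Nn => /(wA _ t _ sy) /eqP.
exists (S `|` a @` N).
  apply: (@cone_simplex _ _ M) => //.
  - exact: sub_finite_set fs.
  - exact: simplex_face Ks Ss.
  - by move=> v n Sv Nn; exact: (cone_weight_level fs sy Sv Nn).
  - have [[v|n] wi] := cone_weight_neq0 fs sy t; first by exists v; left.
    by exists (a n); right; exists n.
by move=> [v|n] wi; [left|right; exists n].
Qed.

Lemma cone_weight_cvg s : simplex K s -> forall (y : {ptws V -> R}) t i,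
  geometric_simplex s y ->
  cone_weight z.1 z.2 i @[z --> simplex_nbhs s y t] --> cone_weight y t i.
Proof.
move=> /(@simplex_finite _ _) fs y t i sy.
have c2 : 2 * z.2 @[z --> simplex_nbhs s y t] --> 2 * t.
  by apply: cvgM; [exact: cvg_cst|exact: simplex_nbhs_time].
have ccut : cut z.2 @[z --> simplex_nbhs s y t] --> cut t by exact: cvg_clamp.
have cslide : slide z.2 @[z --> simplex_nbhs s y t] --> slide t.
  by apply: cvg_clamp; apply: cvgB => //; exact: cvg_cst.
have ctail n : tail_mass n z.1 @[z --> simplex_nbhs s y t] --> tail_mass n y.
  rewrite (tail_massE fs sy).
  have : \forall z \near simplex_nbhs s y t,
      \sum_(v <- fset_set s | (n <= l v)%N) z.1 v = tail_mass n z.1.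
    by apply: filterS (simplex_nbhs_in s y t) => z sz; rewrite (tail_massE fs sz).
  move=> /near_eq_cvg e; apply: (cvg_trans e) => {e}.
  by apply: cvg_big => [z|v _]; [exact: add_continuous|exact: simplex_nbhs_coord].
case: i => [v|n] /=.
  by apply: cvg_max; [exact: cvg_cst|apply: cvgB => //; exact: simplex_nbhs_coord].
apply: cvgD; last first.
  by apply: cvgM; [exact: cvgM|exact: cvg_cst].
apply: cvgM; first by apply: cvgB => //; exact: cvg_cst.
by apply: cvgB; exact: cvg_min.
Qed.

Let apex_simplex : simplex K [set a 0%N].
Proof.
rewrite -[X in simplex K X]set0U; by apply: cone_simplex1 => // -[].
Qed.

Let apex_in : geometric_simplex [set a 0%N] (fun v => (v == a 0%N)%:R : R).
Proof.
split => [v|v /eqP/negbTE -> //|]; first exact: ler0n.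
by rewrite fsbig_set1 eqxx.
Qed.

Lemma cone_null_homotopic : exists x0 : realization R K,
  homotopic R id (fun _ : realization R K => x0).
Proof.
exists (RealizationPoint (ex_intro2 _ _ _ apex_simplex apex_in)).
have [|||||H [cH HE]] := @pushforward_map R V V _ K K cone_vertex cone_weight.
- by move=> s y t i /(@simplex_finite _ _) fs sy; exact: (cone_weight_ge0 fs sy).
- by move=> s y t /(@simplex_finite _ _) fs sy; exact: (cone_weight_neq0 fs sy).
- exact: cone_weight_fin.
- exact: cone_weight_in.
- exact: cone_weight_cvg.
exists H; split=> // x; apply: coords_inj; rewrite HE; have [s Ks sx] := coords_simplex x.
  have [x_ge0 _ _] := sx.
  have cut0 : cut 0 = 0 by rewrite /cut mulr0 clamp0.
  have slide0 : slide 0 = 0 by apply: clamp_le0; lra.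
  rewrite (@pushforward_restrict _ _ _ _ (@inl V nat)) => [|? ? []//|].
    rewrite -[RHS](pushforward_id sx); congr pushforward.
    by apply/funext => v /=; rewrite cut0 subr0 (max_idPr _).
  move=> [v|n] iv; first by exfalso; apply: iv; exists v.
  rewrite /= cut0 slide0 !mul0r addr0.
  by rewrite !(min_idPr _) ?subrr ?mulr0//; exact: (tail_mass_ge0 (simplex_finite Ks) sx).
have cut1 : cut 1 = 1 by apply: clamp_ge1; lra.
have slide1 : slide 1 = 1 by apply: clamp_ge1; lra.
rewrite (@pushforward_restrict _ _ _ _ (fun _ : unit => inr 0%N : V + nat)%type).
- apply/funext => u; rewrite /pushforward /= cut1 slide1.
  rewrite subrr mul0r add0r !mulr1 (_ : [set: unit] = [set tt]); last first.
    by apply/seteqP; split => [[]|].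
  rewrite fsbig_set1 divr1; have [->|ua] := eqVneq u (a 0%N).
    rewrite (_ : _ @^-1` _ = [set tt]) ?fsbig_set1//.
    by apply/seteqP; split => [[]|[]].
  by rewrite fsbig1// => -[/= au]; rewrite au eqxx in ua.
- by move=> [] [].
move=> [v|n] iv; last first.
  case: n iv => [iv|n _]; first by exfalso; apply: iv; exists tt.
  by rewrite /= slide1 subrr mul0r mulr0 addr0.
rewrite /= cut1; apply/max_idPl; rewrite subr_le0.
have fs := simplex_finite Ks.
by rewrite -(tail_mass0 fs sx); exact: (le_tail_mass fs sx (leq0n _)).
Qed.

End Cone.

(** * Barycentric subdivision *)

Section LayerWeights.
Variables (R : realType) (V : choiceType).
Implicit Types (A B : {fset V}) (y : V -> R).

(** Up to normalization, a weight of the face A in a barycentric subdivision.  It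
is positive exactly when A is nonempty and each coordinate on A exceeds the
total mass outside of A.  As the coordinates add up to 1, this condition involves
those on A alone; it forces the faces of positive weight to be nested. *)
Definition layer_weight y A : R :=
  (A != fset0)%:R * \prod_(v <- A) Num.max 0 (y v - (1 - \sum_(u <- A) y u)).

Lemma layer_weight_cvg (s : set V) (y : {ptws V -> R}) t A :
  layer_weight z.1 A @[z --> simplex_nbhs s y t] --> layer_weight y A.
Proof.
apply: cvgM; first exact: cvg_cst.
apply: cvg_big => [z|v _]; first exact: mul_continuous.
apply: cvg_max; first exact: cvg_cst.
apply: cvgB; first exact: simplex_nbhs_coord.
apply: cvgB; first exact: cvg_cst.
by apply: cvg_big => [z|u _]; [exact: add_continuous|exact: simplex_nbhs_coord].
Qed.

Lemma layer_weight_ge0 y A : 0 <= layer_weight y A.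
Proof. by rewrite mulr_ge0 ?ler0n// prodr_ge0// => v _; rewrite le_max lexx. Qed.

Lemma layer_weight_gt y A : layer_weight y A != 0 ->
  A != fset0 /\ forall v, v \in A -> 1 - \sum_(u <- A) y u < y v.
Proof.
rewrite mulf_eq0 negb_or pnatr_eq0 eqb0 negbK => /andP[-> wA]; split => // v vA.
rewrite ltNge -subr_le0; apply: contra wA => yv.
by rewrite (big_fsetD1 v)//= (max_idPl yv) mul0r.
Qed.

Section Simplex.
Variables (s : set V) (y : {ptws V -> R}).
Hypotheses (fs : finite_set s) (sy : geometric_simplex s y).

Let y_ge0 v : 0 <= y v. Proof. by case: sy. Qed.
Let y_out v : ~ s v -> y v = 0. Proof. by case: sy => _ + _; apply. Qed.

Lemma fsum_le1 A : \sum_(v <- A) y v <= 1.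
Proof.
have [_ _ <-] := sy; rewrite (@fsum_simplex _ _ _ _ (fset_set s `|` A)%fset)//.
  rewrite [leRHS](big_fsetID _ [in A])/= [X in X + _](_ : _ = \sum_(v <- A) y v).
    by rewrite lerDl sumr_ge0.
  apply: eq_fbigl => v; rewrite !inE andb_idl// => vA.
  by rewrite vA orbT.
by move=> v; rewrite in_fsetU negb_or in_fset_set// => /andP[/negP vs _];
  apply: y_out => sv; apply: vs; rewrite mem_set.
Qed.

Lemma layer_weight_sub A : layer_weight y A != 0 -> [set` A] `<=` s.
Proof.
move=> /layer_weight_gt[_ yA] v /yA; apply: contraPP => /y_out ->.
by apply/negP; rewrite -leNgt subr_ge0 fsum_le1.
Qed.

(** Given v in A but not in B and u in B but not in A, the coordinate of v is at
most the mass outside B, which is less than that of u, and conversely. *)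
Lemma layer_weight_nested A B :
  layer_weight y A != 0 -> layer_weight y B != 0 ->
  (A `<=` B)%fset \/ (B `<=` A)%fset.
Proof.
move=> /layer_weight_gt[_ yA] /layer_weight_gt[_ yB].
have le_out (C : {fset V}) v : v \notin C -> y v <= 1 - \sum_(u <- C) y u.
  move=> vC; rewrite lerBrDr;  apply: (le_trans _ (fsum_le1 (v |` C)%fset)).
  by rewrite big_fsetU1.
have [|/fsubsetPn[v vA vB]] := boolP (A `<=` B)%fset; first by left.
have [|/fsubsetPn[u uB uA]] := boolP (B `<=` A)%fset; first by right.
have := yA _ vA; rewrite ltNge => /negP[].
rewrite (le_trans (le_out _ _ vB))// (le_trans (ltW (yB _ uB)))//.
exact: le_out.
Qed.

(** The support of y always has positive weight: no mass is left outside. *)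
Lemma layer_weight_neq0 : exists A, layer_weight y A != 0.
Proof.
pose A := [fset v in fset_set s | y v != 0]%fset.
have A0 v : v \notin A -> y v = 0.
  rewrite !inE negb_and negbK in_fset_set// => /orP[/negP vs|/eqP//].
  by apply: y_out => sv; apply: vs; rewrite mem_set.
have sA : \sum_(v <- A) y v = 1.
  by rewrite -(fsum_simplex fs y_out A0); case: sy.
exists A; rewrite mulf_neq0//.
  rewrite pnatr_eq0 eqb0 negbK; apply/eqP => A00.
  by move: sA; rewrite A00 big_seq_fset0 => /esym/eqP; rewrite oner_eq0.
rewrite sA subrr prodf_seq_neq0; apply/allP => v; rewrite !inE => /andP[_ yv] /=.
by rewrite subr0 (max_idPr _).
Qed.
End Simplex.
End LayerWeights.

(** * The order complex as a homotopy retract of the nerve *)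

Section SimplicialInclusion.
Variables (R : realType) (V : choiceType).

Lemma realization_inclusion (K L : simplicial_complex V) :
  (forall s, simplex K s -> simplex L s) ->
  exists j : realization R K -> realization R L,
    continuous j /\ forall x, coords (j x) = coords x.
Proof.
move=> KL; have y_in s (y : {ptws V -> R}) v : geometric_simplex s y -> y v != 0 -> s v.
  by move=> [_ ys _]; apply: contraPP => /ys ->; rewrite eqxx.
have [|||||H [cH HE]] := @pushforward_map R V V _ K L id (fun y _ v => y v).
- by move=> s y t v _ [].
- move=> s y t _ [_ ys sy]; apply: contrapT => /forallNP y0.
  by move: sy; rewrite fsbig1 => [/esym/eqP|v _]; [rewrite oner_eq0|apply/eqP/negPn/negP].
- move=> s /(@simplex_finite _ _) fs; exists (fset_set s) => y t v [_ ys _].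
  by rewrite in_fset_set// => /negP vs; apply: ys => sv; apply: vs; rewrite mem_set.
- by move=> s y t Ks sy; exists s; [exact: KL|move=> v; exact: y_in].
- by move=> s _ y t v _; exact: simplex_nbhs_coord.
exists (fun x => H (x, 0)); split; first exact: continuous_at0.
by move=> x; have [s _ sx] := coords_simplex x; rewrite HE (pushforward_id sx).
Qed.
End SimplicialInclusion.

Section OrderComplexOfNerve.
Variables (R : realType) (X : Type) (Q : set (set X)).
Variable K : simplicial_complex (set X).

Hypothesis Q_neq0 : forall C, Q C -> C !=set0.
Hypothesis Q_setI : forall C D, Q C -> Q D -> C `&` D !=set0 -> Q (C `&` D).
Hypothesis simplexKE : forall s, simplex K s <->
  [/\ finite_set s, s !=set0, s `<=` Q & \bigcap_(C in s) C !=set0].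

Definition meet (A : {fset (set X)}) : set X := \bigcap_(C in [set` A]) C.

Lemma total_fset_min (r : seq (set X)) : r != [::] ->
  total_on [set` r] (fun C D => C `<=` D) ->
  exists2 C, C \in r & \big[setI/setT]_(D <- r) D = C.
Proof.
elim: r => // C r IH _ tot.
have [->|r0] := eqVneq r [::].
  by exists C; rewrite ?mem_head ?big_seq1.
have [|D Dr rD] := IH r0.
  by move=> A B Ar Br; apply: tot; rewrite /= inE; apply/orP; right.
rewrite big_cons rD.
have [CD|DC] : C `<=` D \/ D `<=` C.
  by apply: tot; rewrite /= inE ?eqxx ?Dr ?orbT.
- by exists C; rewrite ?mem_head//; apply/setIidPl.
- by exists D; rewrite ?inE ?Dr ?orbT//; apply/setIidPr.
Qed.

Lemma meet_seq_in (r : seq (set X)) x : r != [::] ->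
  (forall C, C \in r -> Q C /\ C x) -> Q (\big[setI/setT]_(C <- r) C).
Proof.
elim: r => // C r IH _ rQ.
have [QC Cx] := rQ C (mem_head _ _).
have [->|r0] := eqVneq r [::]; first by rewrite big_seq1.
have rQ' D : D \in r -> Q D /\ D x by move=> Dr; apply: rQ; rewrite inE Dr orbT.
rewrite big_cons; apply: Q_setI => //; first exact: IH.
by exists x; split => //; rewrite -bigcap_seq => D /rQ'[].
Qed.

Lemma meet_in (s : set (set X)) (A : {fset (set X)}) :
  simplex K s -> A != fset0 -> [set` A] `<=` s -> Q (meet A).
Proof.
move=> /simplexKE[_ _ sQ [x sx]] A0 As; rewrite /meet bigcap_seq; apply: (@meet_seq_in _ x).
  by apply: contra_neq A0 => A0; apply/fsetP => C; rewrite -[LHS]/(C \in enum_fset A) A0 !inE.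
by move=> C CA; split; [apply: sQ; exact: As|apply: sx; exact: As].
Qed.

(** The least element of a chain is the common intersection of its members. *)
Lemma chain_nerve s : simplex (order_complex Q) s -> simplex K s.
Proof.
move=> [fs s0 sQ tot]; apply/simplexKE; split => //.
have [C Cs sC] : exists2 C, C \in (fset_set s : seq _) &
    \big[setI/setT]_(D <- fset_set s) D = C.
  apply: total_fset_min.
    case: s0 => C sC; apply/eqP => s0.
    suff : C \in (fset_set s : seq _) by rewrite s0.
    by rewrite in_fset_set// mem_set.
  move=> C D /=; rewrite !in_fset_set// => /set_mem sC /set_mem sD.
  by have := tot _ _ sC sD; rewrite !subsetEset.
rewrite -(fset_setK fs) bigcap_seq sC; apply: Q_neq0; apply: sQ.
by move: Cs; rewrite in_fset_set// => /set_mem.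
Qed.

(** Weight is given to nested families of cosets only, and their intersections
form a chain. *)
Lemma meet_retraction :
  exists r : realization R K -> realization R (order_complex Q),
    continuous r /\ forall x, coords (r x) = pushforward meet (layer_weight (coords x)).
Proof.
have [|||||H [cH HE]] := @pushforward_map R (set X) (set X) {fset (set X)} K
  (order_complex Q) meet (fun y _ A => layer_weight y A).
- by move=> *; exact: layer_weight_ge0.
- by move=> s y t /(@simplex_finite _ _) fs sy; exact: layer_weight_neq0 sy.
- move=> s /(@simplex_finite _ _) fs; exists (fpowerset (fset_set s)) => y t A sy.
  apply: contraNeq => /(layer_weight_sub fs sy) As; rewrite fpowersetE.
  by apply/fsubsetP => C CA; rewrite in_fset_set// mem_set//; exact: As.
- move=> s y t Ks sy; have fs := simplex_finite Ks.
  exists (meet @` [set A | layer_weight y A != 0]); last by move=> A wA; exists A.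
  split.
  + apply: finite_image; apply: (@sub_finite_set _ _ [set` fpowerset (fset_set s)]) => //.
    move=> A /(layer_weight_sub fs sy) As /=; rewrite fpowersetE.
    by apply/fsubsetP => C CA; rewrite in_fset_set// mem_set//; exact: As.
  + by have [A wA] := layer_weight_neq0 fs sy; exists (meet A); exists A.
  + move=> _ [A wA <-]; apply: (meet_in Ks); first by case: (layer_weight_gt wA).
    exact: layer_weight_sub wA.
  + move=> _ _ [A wA <-] [B wB <-]; rewrite !subsetEset.
    case: (layer_weight_nested fs sy wA wB) => /fsubsetP AB; [right|left];
      by move=> x xI C /AB; exact: xI.
- by move=> s Ks y t A sy; exact: layer_weight_cvg.
exists (fun x => H (x, 0)); split; first exact: continuous_at0.
by move=> x; rewrite HE.
Qed.

(** For a point of the order complex carried by a chain s, the families of positive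
weight are nonempty subsets of s, and their intersections are their least
elements.  So r maps the simplex s to itself, and straight lines work. *)
Lemma order_complex_retract :
  exists (j : realization R (order_complex Q) -> realization R K)
         (r : realization R K -> realization R (order_complex Q)),
    [/\ continuous j, continuous r & homotopic R id (r \o j)].
Proof.
have [j [cj jE]] := @realization_inclusion R _ _ _ chain_nerve.
have [r [cr rE]] := meet_retraction.
exists j, r; split => //.
pose vertex (i : set X + {fset (set X)}) :=
  match i with inl C => C | inr A => meet A end.
pose weight (y : {ptws set X -> R}) t (i : set X + {fset (set X)}) :=
  match i with
  | inl C => (1 - clamp t) * y C
  | inr A => clamp t * layer_weight y A
  end.
have [|||||H [cH HE]] := @pushforward_map R _ _ _ (order_complex Q)
  (order_complex Q) vertex weight.
- move=> s y t [C|A] _ [y_ge0 _ _] /=; first by rewrite mulr_ge0// subr_ge0 clamp_le1.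
  by rewrite mulr_ge0 ?clamp_ge0 ?layer_weight_ge0.
- move=> s y t /(@simplex_finite _ _) fs sy.
  have [A wA] := layer_weight_neq0 fs sy.
  have [ct|ct] := eqVneq (clamp t) 0; last by exists (inr A); rewrite /= mulf_neq0.
  have [_ _ s1] := sy; apply: contrapT => /forallNP y0.
  move: s1; rewrite fsbig1 => [/esym/eqP|C _]; first by rewrite oner_eq0.
  by have := y0 (inl C); rewrite /= ct subr0 mul1r => /negP/negPn/eqP.
- move=> s /(@simplex_finite _ _) fs.
  exists ([fset inl C | C in fset_set s] `|`
          [fset inr A | A in fpowerset (fset_set s)])%fset.
  move=> y t [C|A] sy; rewrite in_fsetU negb_or => /andP[iC iA] /=.
    rewrite (_ : y C = 0) ?mulr0//.
    case: sy => _ + _; apply; apply: contraNnot iC => sC.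
    by apply/imfsetP; exists C => //=; rewrite in_fset_set// mem_set.
  rewrite (_ : layer_weight y A = 0) ?mulr0//.
  apply: contraNeq iA => /(layer_weight_sub fs sy) As.
  apply/imfsetP; exists A => //=; rewrite fpowersetE.
  by apply/fsubsetP => C CA; rewrite in_fset_set// mem_set//; exact: As.
- move=> s y t Ks sy; have fs := simplex_finite Ks; exists s => // -[C|A] /=.
    by rewrite mulf_eq0 negb_or => /andP[_]; case: sy => _ ys _;
      apply: contra_neqP => /ys.
  rewrite mulf_eq0 negb_or => /andP[_ wA].
  have As := layer_weight_sub fs sy wA.
  have [C CA AC] : exists2 C, C \in (A : seq _) & \big[setI/setT]_(D <- A) D = C.
    apply: total_fset_min.
      have [A0 _] := layer_weight_gt wA; apply: contra_neq A0 => A0.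
      by apply/fsetP => C; rewrite -[LHS]/(C \in enum_fset A) A0 !inE.
    case: Ks => _ _ _ tot C D CA DA.
    by have := tot _ _ (As _ CA) (As _ DA); rewrite !subsetEset.
  by rewrite /meet bigcap_seq AC; exact: As.
- move=> s Ks y t i sy.
  have ct : clamp z.2 @[z --> simplex_nbhs s y t] --> clamp t.
    by apply: cvg_clamp; exact: simplex_nbhs_time.
  case: i => [C|A] /=; apply: cvgM => //; last exact: layer_weight_cvg.
    by apply: cvgB => //; exact: cvg_cst.
  exact: simplex_nbhs_coord.
exists H; split=> // x; apply: coords_inj; rewrite HE.
  have [s Ks sx] := coords_simplex x.
  rewrite (@pushforward_restrict _ _ _ _ (@inl (set X) {fset (set X)})) => [|? ? []//|].
    rewrite -[RHS](pushforward_id sx); congr pushforward.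
    by apply/funext => C /=; rewrite clamp0 subr0 mul1r.
  move=> [C|A] iC /=; first by exfalso; apply: iC; exists C.
  by rewrite clamp0 mul0r.
rewrite /= rE jE (@pushforward_restrict _ _ _ _ (@inr (set X) {fset (set X)}))
  => [|? ? []//|].
  by congr pushforward; apply/funext => A /=; rewrite clamp_ge1// mul1r.
move=> [C|A] iA /=; last by exfalso; apply: iA; exists A.
by rewrite clamp_ge1// subrr mul0r.
Qed.

Lemma order_complex_contractible (x0 : realization R K) :
  homotopic R id (fun _ : realization R K => x0) ->
  contractible_complex R (order_complex Q).
Proof.
move=> hK; have [j [r [cj cr hrj]]] := order_complex_retract.
apply: (@contractible_of_homotopic _ _ (r x0)).
by apply: homotopic_trans hrj _; exact: (homotopic_comp cr cj hK).
Qed.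

End OrderComplexOfNerve.

(** * The action on the vertices of a graph *)

Section WordAction.
Variables (X : choiceType) (Gamma : xgraph X).
Hypothesis Gamma_regular : xregular Gamma.

Definition edge_from (v : Gamma) (a : letter X) : hedge Gamma :=
  sval (cid (Gamma_regular v a)).

Lemma edge_from_origin v a : horigin (edge_from v a) = v.
Proof. by rewrite /edge_from; case: cid => e /= [[? ?] _]. Qed.

Lemma edge_from_label v a : hlabel (edge_from v a) = a.
Proof. by rewrite /edge_from; case: cid => e /= [[? ?] _]. Qed.

Lemma edge_from_unique e : edge_from (horigin e) (hlabel e) = e.
Proof. by rewrite /edge_from; case: cid => e' /= [_]; exact. Qed.

Definition act (v : Gamma) (s : seq (letter X)) : Gamma :=
  foldl (fun v a => hterminus (edge_from v a)) v s.

Lemma hinv_label (e : hedge Gamma) : hlabel (hinv e) = inv_letter (hlabel e).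
Proof. by case: e => e []. Qed.

Lemma hinv_origin (e : hedge Gamma) : horigin (hinv e) = hterminus e.
Proof. by case: e => e []. Qed.

Lemma hinv_terminus (e : hedge Gamma) : hterminus (hinv e) = horigin e.
Proof. by case: e => e []. Qed.

Lemma act_inv_letter v a : act v [:: a; inv_letter a] = v.
Proof.
rewrite /=; have -> : inv_letter a = hlabel (hinv (edge_from v a)).
  by rewrite hinv_label edge_from_label.
rewrite -[hterminus (edge_from v a)]hinv_origin.
by rewrite edge_from_unique hinv_terminus edge_from_origin.
Qed.

Lemma act_cons_reduce v a s : act v (cons_reduce a s) = act v (a :: s).
Proof.
case: s => [|b s] //; rewrite /cons_reduce; case: eqP => // ->.
by rewrite -[in LHS](act_inv_letter v a).
Qed.

Lemma act_mul v (u t : free_group X) : act v (u * t)%g = act (act v u) t.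
Proof.
rewrite -[LHS]/(act v (foldr (@cons_reduce X) t u)).
elim: (word_of u) v => // a s IH v.
by rewrite [foldr _ _ _]/= act_cons_reduce /= -IH.
Qed.

Lemma actKV v (u : free_group X) : act (act v u) u^-1%g = v.
Proof. by rewrite -act_mul mulgV. Qed.

Lemma act_exp v (u : free_group X) i : act v (u ^+ i)%g = iter i (act^~ u) v.
Proof. by elim: i v => // i IH v; rewrite expgS act_mul IH iterSr. Qed.

Lemma walk_terminus v (es : seq (hedge Gamma)) : is_walk v es ->
  last v (map (@hterminus _ Gamma) es) = act v (map (@hlabel _ Gamma) es).
Proof.
elim: es v => //= e es IH v [<- /IH ->].
by rewrite edge_from_unique.
Qed.

Lemma path_terminus (q : xpath Gamma) : pterminus q = act (porigin q) (plabel q).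
Proof. by rewrite /pterminus walk_terminus//; exact: pedges_walk. Qed.

Lemma word_walk v (s : seq (letter X)) : exists es : seq (hedge Gamma),
  is_walk v es /\ map (@hlabel _ Gamma) es = s.
Proof.
elim: s v => [|a s IH] v; first by exists [::].
have [es [wes <-]] := IH (hterminus (edge_from v a)).
by exists (edge_from v a :: es); rewrite /= edge_from_origin edge_from_label.
Qed.

(** The hypothesis on relators speaks of reduced paths only; the path spelling a
freely reduced word is reduced, since e followed by its inverse would spell a
cancelling pair of letters. *)
Lemma relator_act Rel : fulfills_relators Gamma Rel ->
  forall r : free_group X, Rel r -> forall v, act v r = v.
Proof.
move=> fRel r Rr v; have [es [wes esr]] := word_walk v r.
pose q := XPath wes.
rewrite -esr -[in RHS](fRel v r Rr q) ?path_terminus//.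
move=> s t e /= est; have := free_group_red r; rewrite -esr est map_cat /=.
rewrite /freely_reduced sorted_cat_cons => /andP[_ /= /andP[+ _]].
by rewrite hinv_label eqxx.
Qed.

End WordAction.

(** A permutation of p points one of whose orbits is exhausted by p iterates is a
p-cycle. *)
Lemma cyclic_iter (T : Type) (f : T -> T) (v : T) p :
  injective f -> ([set: T] #= `I_p)%card -> (0 < p)%N ->
  (forall u, exists2 i, (i < p)%N & u = iter i f v) ->
  iter p f v = v /\ (1 < p -> f v <> v)%N.
Proof.
move=> fI cT p0 surj.
(* The p iterates exhaust a set with p elements, so none of them is repeated. *)
have inj i j : (i < j < p)%N -> iter i f v <> iter j f v.
  move=> /andP[ij jp] e.
  have /card_eqPle[_ pT] := cT.
  have : ([set: T] #<= `I_p.-1)%card.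
    rewrite (_ : [set: T] = (fun k => iter (if (k < j)%N then k else k.+1) f v) @` `I_p.-1).
      exact: card_image_le.
    apply/seteqP; split => // u _; have [k kp ->] := surj u.
    case: (ltngtP k j) => kj.
    - by exists k; rewrite /= ?kj//; lia.
    - exists k.-1; first by rewrite /=; lia.
      by rewrite ifF ?(ltn_predK kj)//; apply/negbTE; lia.
    - by exists i; rewrite /= ?ij ?e ?kj//; lia.
  move=> /(card_le_trans pT); rewrite card_le_II; lia.
have [i ip pi] := surj (iter p f v).
have iterI k : injective (iter k f) by elim: k => // k IH x y /= /fI /IH.
have i0 : i = 0%N.
  apply/eqP; rewrite -leqn0 leqNgt; apply/negP => i0.
  have [] := @inj 0%N (p - i)%N; first by lia.
  by apply: (iterI i); rewrite -!iterD addn0 subnKC ?(ltnW ip).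
by rewrite pi i0; split => // p1 fv; apply: (@inj 0%N 1%N).
Qed.

Local Open Scope group_scope.

Section MultiplicativeMaps.
Variables (G H : groupType) (phi : {multiplicative G -> H}).

Lemma mul_morph1 : phi 1 = 1.
Proof. by apply: (mulgI (phi 1)); rewrite -gmulfM !mulg1. Qed.

Lemma mul_morphV x : phi x^-1 = (phi x)^-1.
Proof. by apply: (mulgI (phi x)); rewrite -gmulfM !mulgV mul_morph1. Qed.

Lemma mul_morphX x n : phi (x ^+ n) = phi x ^+ n.
Proof. by elim: n => [|n IH]; rewrite ?mul_morph1// !expgS gmulfM IH. Qed.
End MultiplicativeMaps.

Section VertexStabilizer.
Variables (X : choiceType) (Rel : set (free_group X)) (G : groupType).
Variable phi : {multiplicative free_group X -> G}.
Hypothesis phi_surj : forall g, exists u, phi u = g.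
Hypothesis phi_ker : [set u | phi u = 1] = smallest (@is_normal_subgroup _) Rel.
Variable Gamma : xgraph X.
Hypothesis Gamma_regular : xregular Gamma.
Hypothesis Gamma_relators : fulfills_relators Gamma Rel.

Local Notation act := (act Gamma_regular).

Lemma act_ker u x : phi u = 1 -> act x u = x.
Proof.
move=> u1; pose N : set (free_group X) := [set u | forall x, act x u = x].
have : N u.
  apply: (@smallest_sub _ (@is_normal_subgroup _) Rel); last by rewrite -phi_ker.
    split; first split.
    - by apply/mem_set => y.
    - move=> s t /set_mem sN /set_mem tN; apply/mem_set => y.
      by rewrite act_mul sN -[in LHS](tN y) actKV.
    - by move=> g n nN y; rewrite /conjg !act_mul nN -act_mul mulVg.
  by move=> r Rr y; exact: relator_act Gamma_relators _ Rr y.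
exact.
Qed.

Lemma act_phi u t x : phi u = phi t -> act x u = act x t.
Proof.
move=> ut; have : act (act x t) (t^-1 * u) = act x t.
  by apply: act_ker; rewrite gmulfM mul_morphV ut mulVg.
by rewrite act_mul actKV.
Qed.

Variable v : Gamma.

(** The coset of elements moving v to x; for x = v it is the stabilizer.  It is
described through words, so that the action of G need not be named. *)
Definition transporter (x : Gamma) : set G :=
  [set g | exists2 u, phi u = g & act v u = x].

Lemma transporterP u x : transporter x (phi u) <-> act v u = x.
Proof. by split=> [[t /esym/act_phi -> //]|]; exists u. Qed.

Lemma stabilizer_subgroup : is_subgroup (transporter v).
Proof.
split; first by apply/mem_set; exists 1; rewrite ?mul_morph1.
move=> g h /set_mem[u <- uv] /set_mem[t <- tv]; apply/mem_set.
exists (u * t^-1); first by rewrite gmulfM mul_morphV.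
by rewrite act_mul uv -[in LHS]tv actKV.
Qed.

Lemma stabilizer_coset u : right_coset (transporter v) (phi u) = transporter (act v u).
Proof.
apply/seteqP; split => [_ [_ [t <- tv] <-]|_ [t <- tu]].
  by exists (t * u); rewrite ?gmulfM// act_mul tv.
exists (phi (t * u^-1)); last by rewrite -gmulfM mulgVK.
by exists (t * u^-1) => //; rewrite act_mul tu actKV.
Qed.

Lemma stabilizer_finite_index :
  finite_set [set: Gamma] -> finite_index (transporter v).
Proof.
move=> fG; apply: (@sub_finite_set _ _ (transporter @` setT)).
  move=> _ [g _ <-]; have [u <-] := phi_surj g.
  by rewrite stabilizer_coset; exists (act v u).
exact: finite_image.
Qed.

Variables (p : nat) (w : free_group X).
Hypothesis p_gt1 : (1 < p)%N.
Hypothesis Gamma_card : ([set: Gamma] #= `I_p)%card.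
Hypothesis w_transitive : forall x, exists2 i, (i < p)%N & x = act v (w ^+ i).

Let act_w x i : act x (w ^+ i) = iter i (act^~ w) x.
Proof. exact: act_exp. Qed.

Let w_cycle : act v (w ^+ p) = v /\ act v w <> v.
Proof.
have [||||] := @cyclic_iter Gamma (act^~ w) v p.
- by move=> x y /(congr1 (act^~ w^-1)); rewrite !actKV.
- exact: Gamma_card.
- exact: ltnW.
- by move=> x; have [i ip ->] := w_transitive x; exists i; rewrite ?act_w.
- by rewrite act_w => -> /(_ p_gt1).
Qed.

Lemma stabilizer_in_H_fi : H_fi G (transporter v).
Proof.
split; first exact: stabilizer_subgroup.
  apply/eqP => vT; have : transporter v (phi w) by rewrite vT.
  by move/transporterP; case: w_cycle.
by apply: stabilizer_finite_index; exists p.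
Qed.

Lemma stabilizer_period g : transporter v g -> transporter v (g * phi w ^+ p).
Proof.
move=> [u <- uv]; exists (u * w ^+ p); first by rewrite gmulfM mul_morphX.
by rewrite act_mul uv; case: w_cycle.
Qed.

(** Powers of b with exponents divisible by D still act transitively on the p
vertices, because D is invertible modulo p. *)
Lemma stabilizer_meets g D : coprime D p ->
  exists j, transporter v (g * phi w ^+ (D * j)).
Proof.
move=> Dp; have [u <-] := phi_surj g.
have [i ip ui] := w_transitive (act v u).
have D0 : (0 < D)%N.
  by rewrite lt0n; apply/eqP => D0; move: Dp; rewrite D0 /coprime gcd0n; lia.
have [[a c] /= Dac] := coprimeP _ D0 Dp.
exists (a * (p - i))%N.
suff : act v (u * w ^+ (D * (a * (p - i)))) = v.
  by move/transporterP; rewrite gmulfM mul_morphX.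
rewrite act_mul ui -act_mul -expgnDr.
(* From a D = 1 + c p: the exponent i + D j is a multiple of p. *)
have -> : (i + D * (a * (p - i)) = p * (1 + c * (p - i)))%N by nia.
elim: (1 + _)%N => [|k IH]; first by rewrite muln0.
by rewrite mulnS expgnDr act_mul; case: w_cycle => -> _.
Qed.

End VertexStabilizer.

(** * Cosets of subgroups of finite index *)

Section Cosets.
Variable G : groupType.
Implicit Types (H K C D : set G) (g x : G).

Lemma in_right_coset H g x : right_coset H g x <-> H (x * g^-1).
Proof.
split=> [[h Hh <-]|Hx]; first by rewrite mulgK.
by exists (x * g^-1) => //; rewrite mulgVK.
Qed.

Lemma subgroupM H x y : is_subgroup H -> H x -> H y -> H (x * y).
Proof.
move=> [/set_mem H1 HF] Hx Hy.
have Hy' : H y^-1.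
  by have := set_mem (HF 1 y (mem_set H1) (mem_set Hy)); rewrite /= mul1g.
by have := set_mem (HF x y^-1 (mem_set Hx) (mem_set Hy')); rewrite /= invgK.
Qed.

Lemma subgroupV H x : is_subgroup H -> H x -> H x^-1.
Proof.
move=> [/set_mem H1 HF] Hx.
by have := set_mem (HF 1 x (mem_set H1) (mem_set Hx)); rewrite /= mul1g.
Qed.

Lemma right_coset_eq H g x : is_subgroup H ->
  right_coset H g x -> right_coset H g = right_coset H x.
Proof.
move=> sH /in_right_coset Hx; apply/seteqP.
split=> y /in_right_coset Hy; apply/in_right_coset.
  have -> : y * x^-1 = (y * g^-1) * (x * g^-1)^-1 by rewrite invgM invgK mulgA mulgVK.
  by apply: subgroupM => //; exact: subgroupV.
have -> : y * g^-1 = (y * x^-1) * (x * g^-1) by rewrite mulgA mulgVK.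
exact: subgroupM.
Qed.

Lemma right_cosetI H K g :
  right_coset (H `&` K) g = right_coset H g `&` right_coset K g.
Proof.
apply/seteqP; split=> y; first by move/in_right_coset=> [? ?]; split; apply/in_right_coset.
by move=> [/in_right_coset ? /in_right_coset ?]; apply/in_right_coset.
Qed.

Lemma H_fiI H K : H_fi G H -> H_fi G K -> H_fi G (H `&` K).
Proof.
move=> [sH HT fH] [sK _ fK]; split.
- case: (sH) => /set_mem H1 HF; case: (sK) => /set_mem K1 KF.
  split; first by apply/mem_set.
  move=> x y /set_mem[Hx Kx] /set_mem[Hy Ky]; apply/mem_set; split.
    by have := set_mem (HF _ _ (mem_set Hx) (mem_set Hy)).
  by have := set_mem (KF _ _ (mem_set Kx) (mem_set Ky)).
- apply: contra_neq HT => HK; apply/seteqP; split => // x _.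
  by have [] : (H `&` K) x by rewrite HK.
- apply: sub_finite_set (finite_image2 setI fH fK).
  move=> _ [g _ <-]; exists (right_coset H g); first by exists g.
  by exists (right_coset K g); [exists g|rewrite right_cosetI].
Qed.

Lemma P_fiI C D : P_fi G C -> P_fi G D -> C `&` D !=set0 -> P_fi G (C `&` D).
Proof.
move=> [H Hfi [g ->]] [K Kfi [h ->]] [x [gx hx]].
case: (Hfi) => sH _ _; case: (Kfi) => sK _ _.
exists (H `&` K); first exact: H_fiI.
by exists x; rewrite right_cosetI (right_coset_eq sH gx) (right_coset_eq sK hx).
Qed.

Lemma P_fi_neq0 C : P_fi G C -> C !=set0.
Proof.
move=> [H [[/set_mem H1 _] _ _] [g ->]]; exists g; apply/in_right_coset.
by rewrite mulgV.
Qed.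

Lemma H_fi_coset H : H_fi G H -> P_fi G H.
Proof.
move=> Hfi; exists H => //; exists 1; apply/seteqP.
split=> x; first by move=> Hx; apply/in_right_coset; rewrite invg1 mulg1.
by move/in_right_coset; rewrite invg1 mulg1.
Qed.

Variable b : G.

Definition is_period d C : Prop := (0 < d)%N /\ forall g, C g -> C (g * b ^+ d).

(** The cosets H g b^i take finitely many values, and two equal ones give a
period of H g. *)
Lemma exists_period C : P_fi G C -> exists d, is_period d C.
Proof.
move=> [H [sH _ fH] [g ->]].
pose f i := right_coset H (g * b ^+ i).
have [i [j [ij fij]]] : exists i j, (i < j)%N /\ f i = f j.
  apply: contrapT => inj; apply: infinite_nat.
  rewrite -(@eq_finite_set _ _ (range f)); last first.
    apply: inj_card_eq => i j _ _ fij.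
    case: (ltngtP i j) => // ij; exfalso; apply: inj; first by exists i, j.
    by exists j, i.
  by apply: sub_finite_set fH => _ [i _ <-]; exists (g * b ^+ i).
exists (j - i)%N; split; first by rewrite subn_gt0.
have Hij : H (g * b ^+ (j - i) * g^-1).
  have : f j (g * b ^+ j).
    by apply/in_right_coset; case: sH => /set_mem H1 _; rewrite mulgV.
  rewrite -fij => /in_right_coset; rewrite -(subnK (ltnW ij)) expgnDr.
  by rewrite subnK ?(ltnW ij)// invgM !mulgA mulgK.
move=> x /in_right_coset Hx; apply/in_right_coset.
have -> : x * b ^+ (j - i) * g^-1 = (x * g^-1) * (g * b ^+ (j - i) * g^-1).
  by rewrite !mulgA mulgVK.
exact: subgroupM.
Qed.

Lemma periodM d k C g : is_period d C -> C g -> C (g * b ^+ (d * k)).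
Proof.
move=> [_ Cd]; elim: k g => [|k IH] g Cg; first by rewrite muln0 mulg1.
by rewrite mulnS expgnDr mulgA; apply: IH; exact: Cd.
Qed.

End Cosets.

(** * Contraction of the nerve and the theorem *)

Section NerveCone.
Variables (R : realType) (G : groupType) (b : G) (M : nat -> set G) (p : nat -> nat).
Hypothesis p_prime : forall n, prime (p n).
Hypothesis p_mono : forall n, (p n < p n.+1)%N.
Hypothesis M_fi : forall n, H_fi G (M n).
Hypothesis M_period : forall n, is_period b (p n) (M n).
Hypothesis M_meets : forall n g D, coprime D (p n) ->
  exists j, M n (g * b ^+ (D * j)).

Let p_lt m n : (m < n)%N -> (p m < p n)%N.
Proof.
elim: n => // n IH; rewrite ltnS leq_eqVlt => /predU1P[->//|/IH mn].
exact: ltn_trans (p_mono n).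
Qed.

Let p_ge n : (n <= p n)%N.
Proof. by elim: n => // n IH; exact: leq_ltn_trans (p_mono n). Qed.

(** It suffices that some period is small: the primes increase, so the condition is
inherited by larger n, and a period smaller than a prime is prime to it. *)
Definition period_below (C : set G) (n : nat) : Prop :=
  exists2 d, is_period b d C & (d < p n)%N.

Lemma exists_level : exists l : set G -> nat,
  forall C, P_fi G C -> period_below C (l C) /\
    forall n, period_below C n -> (l C <= n)%N.
Proof.
suff /choice[l lP] : forall C, exists l, P_fi G C -> period_below C l /\
    forall n, period_below C n -> (l <= n)%N by exists l.
move=> C; have [PC|nPC] := pselect (P_fi G C); last by exists 0%N => /nPC.
have exn : exists n, `[< period_below C n >].
  have [d dC] := exists_period b PC; exists d.+1; apply/asboolP.
  by exists d => //; exact: p_ge.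
case: (ex_minnP exn) => l /asboolP lC lmin; exists l => _; split => // n /asboolP.
exact: lmin.
Qed.

Lemma common_period n (s : seq (set G)) :
  (forall C, C \in s -> period_below C n) ->
  exists2 D, coprime D (p n) & forall C, C \in s -> is_period b D C.
Proof.
elim: s => [|C s IH] sP; first by exists 1%N; rewrite ?coprime1n.
have [|D Dp sD] := IH; first by move=> A As; apply: sP; rewrite inE As orbT.
have [d dC dp] := sP C (mem_head _ _).
have d0 : (0 < d)%N by case: dC.
exists (d * D)%N.
  rewrite coprimeMl Dp andbT coprime_sym prime_coprime//.
  by apply/negP => /(dvdn_leq d0); rewrite leqNgt dp.
have D0 : (0 < D)%N.
  rewrite lt0n; apply/eqP => D0; move: Dp (prime_gt1 (p_prime n)).
  by rewrite D0 /coprime gcd0n => /eqP ->.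
move=> A; rewrite inE => /predU1P[->|/sD AD]; split; rewrite ?muln_gt0 ?d0// => g Ag.
  exact: periodM.
by rewrite mulnC; exact: periodM.
Qed.

Lemma nerve_null_homotopic : exists x0 : realization R (nerve_complex (H_fi G)),
  homotopic R id (fun _ : realization R (nerve_complex (H_fi G)) => x0).
Proof.
have [l lP] := exists_level.
have below C n : P_fi G C -> (l C <= n)%N -> period_below C n.
  move=> PC ln; have [[d dC dl] _] := lP C PC; exists d => //.
  apply: leq_trans dl _; move: ln; rewrite leq_eqVlt => /predU1P[->//|/p_lt/ltnW//].
apply: (@cone_null_homotopic R (set G) (nerve_complex (H_fi G)) M l); last first.
  move=> n; have [_ h] := lP _ (H_fi_coset (M_fi n)); apply: h.
  by exists (p n); [exact: M_period|exact: p_mono].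
move=> s n fs Ks ls.
have sP : s `<=` P_fi G.
  by move=> C sC; have [_ _ sP _] := Ks (ex_intro _ C sC); exact: sP.
have [g sg] : exists g, forall C, s C -> C g.
  have [->|/set0P /Ks[_ _ _ [g sg]]] := eqVneq s set0; first by exists 1.
  by exists g.
have [D Dp sD] : exists2 D, coprime D (p n) & forall C, C \in fset_set s -> is_period b D C.
  apply: common_period => C; rewrite in_fset_set// => /set_mem sC.
  by apply: below; [exact: sP|exact: ls].
have [j Mj] := M_meets g Dp.
split.
- by rewrite finite_setU.
- by exists (M n); right.
- by move=> C [/sP//|->]; exact: H_fi_coset.
- exists (g * b ^+ (D * j)) => C [sC|->//].
  by apply: periodM; [apply: sD; rewrite in_fset_set// mem_set|exact: sg].
Qed.
End NerveCone.

Lemma apex_subgroup (X : choiceType) (Rel : set (free_group X)) (G : groupType)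
    (phi : {multiplicative free_group X -> G}) (w : free_group X)
    (Gamma : xgraph X) (p : nat) :
  (forall g, exists u, phi u = g) ->
  [set u | phi u = 1] = smallest (@is_normal_subgroup _) Rel ->
  xregular Gamma -> fulfills_relators Gamma Rel ->
  (1 < p)%N -> ([set: Gamma] #= `I_p)%card ->
  (exists (v : Gamma) (q : nat -> xpath Gamma),
    (forall i, (i < p)%N ->
      [/\ preduced (q i), porigin (q i) = v & plabel (q i) = w ^+ i]) /\
    [set pterminus (q i) | i in `I_p] = [set: Gamma]) ->
  exists M : set G, [/\ H_fi G M, is_period (phi w) p M &
    forall g D, coprime D p -> exists j, M (g * phi w ^+ (D * j))].
Proof.
move=> phi_surj phi_ker regG relG p1 cardG [v [q [qP qT]]].
have w_trans x : exists2 i, (i < p)%N & x = act regG v (w ^+ i).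
  have : [set: Gamma] x by [].
  rewrite -qT => -[i ip <-]; exists i => //.
  by have [_ qv qw] := qP i ip; rewrite (path_terminus regG) qv qw.
exists (transporter phi regG v v); split.
- exact: (stabilizer_in_H_fi phi_surj phi_ker relG p1 cardG w_trans).
- split; first exact: ltnW.
  by move=> g; exact: (stabilizer_period p1 cardG w_trans).
- exact: (stabilizer_meets phi_surj phi_ker relG p1 cardG w_trans).
Qed.

Lemma infinite_set_mono (P : set nat) : infinite_set P ->
  exists p : nat -> nat, (forall n, P (p n)) /\ forall n, (p n < p n.+1)%N.
Proof.
move=> infP; have next n : exists m, P m /\ (n < m)%N.
  apply: contrapT => none; apply: infP; apply: sub_finite_set (finite_II n.+1).
  by move=> m Pm /=; rewrite ltnNge; apply/negP => nm; apply: none; exists m.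
have [f fP] := choice next; exists (fun n => iter n f (f 0%N)); split.
  by case=> [|n]; [have [] := fP 0%N|have [] := fP (iter n f (f 0%N))].
by move=> n; have [] := fP (iter n f (f 0%N)).
Qed.

Local Close Scope group_scope.
Local Close Scope ring_scope.

Theorem theorem5p6 (R : realType) (X : finType) (Rel : set (free_group X))
    (G : groupType) (hG : has_presentation Rel G)
    (P : set nat) (hP : infinite_set P) (hPprime : forall p, P p -> prime p)
    (w : free_group X) (Gamma : nat -> xgraph X)
    (hGamma : forall p, P p ->
      [/\ xregular (Gamma p), xgraph_connected (Gamma p),
          fulfills_relators (Gamma p) Rel,
          ([set: Gamma p] #= `I_p)%card
        & exists (v : Gamma p) (q : nat -> xpath (Gamma p)),
            (forall i, (i < p)%N ->
               [/\ preduced (q i), porigin (q i) = v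
                 & plabel (q i) = (w ^+ i)%g]) /\
            [set pterminus (q i) | i in `I_p] = [set: Gamma p]]) :
  contractible_complex R (nerve_complex (H_fi G)) /\
  contractible_complex R (order_complex (P_fi G)).
Proof.
have [phi [phi_surj phi_ker]] := hG.
have [p [Pp p_mono]] := infinite_set_mono hP.
have p_prime n : prime (p n) by exact: hPprime.
have /choice[M MP] : forall n, exists M : set G,
    [/\ H_fi G M, is_period (phi w) (p n) M &
      forall g D, coprime D (p n) -> exists j, M (g * phi w ^+ (D * j))%g].
  move=> n; have [regG _ relG cardG wG] := hGamma _ (Pp n).
  exact: apex_subgroup phi_surj phi_ker regG relG (prime_gt1 (p_prime n)) cardG wG.
have [x0 hx0] : exists x0 : realization R (nerve_complex (H_fi G)),
    homotopic R id (fun _ : realization R (nerve_complex (H_fi G)) => x0).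
  apply: (@nerve_null_homotopic R G (phi w) M p p_prime p_mono) => n.
  - by have [] := MP n.
  - by have [] := MP n.
  - by have [] := MP n.
split; first exact: contractible_of_homotopic hx0.
apply: (order_complex_contractible _ _ _ hx0).
- exact: P_fi_neq0.
- exact: P_fiI.
- by [].
Qed.
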